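(* Let $f=(f_1,\dots,f_m)$ be real-valued functions of a database with sensitivity $s_f$, where $m\ge 2$, and let $1\le k\le m$ be an integer. Let $0<\epsilon\le 0.2$ and $0<\delta\le 0.05$. If the noise scale is set to $$\lambda=\frac{8 s_f\sqrt{k\log(m/\delta)}}{\epsilon}$$ or larger, then the oneshot Laplace mechanism with noise scale $\lambda$, which releases the set of indices of the $k$ smallest noisy values together with fresh-noise approximations of the corresponding true values, is $(\epsilon,\delta)$-differentially private.
   Context: Databases: two databases $D,D'$ are adjacent if one is obtained from the other by removing or adding a single data item. Sensitivity: for $f=(f_1,\dots,f_m)$, $s_f=\max_{D,D'}\max_{1\le i\le m}|f_i(D)-f_i(D')|$, where the maximum is over all adjacent $D,D'$. Differential privacy: a randomized mechanism $\mathcal{M}$ is $(\epsilon,\delta)$-differentially private if for all adjacent $D,D'$ and every subset $S$ of possible outputs, $\mathbb{P}(\mathcal{M}(D)\in S)\le e^{\epsilon}\,\mathbb{P}(\mathcal{M}(D')\in S)+\delta$. Laplace distribution: $\mathrm{Lap}(\lambda)$ has density $\frac{1}{2\lambda}e^{-|z|/\lambda}$ on $\mathbb{R}$. $\log$ is the natural logarithm. Oneshot Laplace mechanism with noise scale $\lambda>0$: on input a database $D$, functions $f=(f_1,\dots,f_m)$ and the parameter $k$, draw $g_1,\dots,g_m$ i.i.d. from $\mathrm{Lap}(\lambda)$, set $y_i=f_i(D)+g_i$ for $1\le i\le m$, and sort the values from low to high, $y_{i_1}\le y_{i_2}\le\cdots\le y_{i_m}$. Return the set $\{i_1,\dots,i_k\}$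 and the approximations $f_{i_j}(D)+g'_{i_j}$ for $1\le j\le k$, where the $g'_{i_j}$ are fresh independent random noise sampled from $\mathrm{Lap}(\lambda)$. *)

(* Defs.v *)
From HB Require Import structures.
From mathcomp Require Import all_boot all_order all_algebra.
From mathcomp Require Import finmap multiset.
From mathcomp Require Import all_classical all_reals all_analysis.
From mathcomp Require Import measurable_realfun.

Set Implicit Arguments.
Unset Strict Implicit.
Unset Printing Implicit Defensive.

Import Order.TTheory GRing.Theory Num.Theory.
Import numFieldNormedType.Exports.

Local Open Scope classical_set_scope.
Local Open Scope ring_scope.

HB.instance Definition _ (I : finType) :=
  isPointed.Build {set I} (finset.set0 : {set I}).
HB.instance Definition _ (I : finType) :=
  @isMeasurable.Build default_measure_display {set I} discrete_measurable
    discrete_measurable0 discrete_measurableC discrete_measurableU.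

Section databases.
Variable X : choiceType.

(* A database is a finite multiset of data items. *)
Definition database := {mset X}%mset.

Definition adjacent_db (D D' : database) : Prop :=
  exists x : X, (D' = x +` D)%mset \/ (D = x +` D')%mset.

Section sensitivity.
Variables (R : realType) (m : nat) (f : 'I_m -> database -> R).

Definition adjacent_changes : set R :=
  [set \big[Num.max/0]_(i < m) `|f i DD.1 - f i DD.2| |
     DD in [set DD : database * database | adjacent_db DD.1 DD.2]].

(* [sup] is 0 on unbounded sets: meaningful only if [adjacent_changes] is
   bounded. *)
Definition sensitivity : R := sup adjacent_changes.

End sensitivity.

Definition differentially_private d d' (T : measurableType d)
    (Y : measurableType d') (R : realType) (P : probability T R)
    (M : database -> {RV P >-> Y}) (eps delta : R) : Prop :=
  forall D D' : database, adjacent_db D D' ->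
  forall S : set Y, measurable S ->
  (P (M D @^-1` S) <= (expR eps)%:E * P (M D' @^-1` S) + delta%:E)%E.

End databases.

Section laplace.
Variable R : realType.

Definition laplace_pdf (lambda z : R) : R :=
  (2 * lambda)^-1 * expR (- (`|z| / lambda)).

Definition laplace_distributed d (T : measurableType d) (P : probability T R)
    (g : {RV P >-> R}) (lambda : R) : Prop :=
  forall A : set R, measurable A ->
  distribution P g A =
    (\int[lebesgue_measure]_(z in A) (laplace_pdf lambda z)%:E)%E.

Definition mutually_independent d (T : measurableType d) (P : probability T R)
    (I : finType) (g : I -> {RV P >-> R}) : Prop :=
  forall (J : {set I}) (A : I -> set R), (forall i, measurable (A i)) ->
  P (\bigcap_(i in [set` J]) (g i @^-1` A i)) =
    (\prod_(i in J) P (g i @^-1` A i))%E.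

End laplace.

Section oneshot.
Variables (R : realType) (X : choiceType) (m : nat).

(* The sort is stable, so ties are broken in favour of the smaller index. *)
Definition smallest_indices (k : nat) (y : 'I_m -> R) : {set 'I_m} :=
  [set i in take k (sort (fun i j => y i <= y j) (enum 'I_m))]%SET.

(* The approximations are released labelled by their index: component i of the
   tuple is the approximation of f i D when i is selected, and the placeholder
   0 otherwise. *)
Definition oneshot_output (k : nat) (f : 'I_m -> database X -> R)
    (D : database X) (g g' : 'I_m -> R) : {set 'I_m} * m.-tuple R :=
  let S := smallest_indices k (fun i => f i D + g i) in
  (S, [tuple if i \in S then f i D + g' i else 0 | i < m]).

Variables (d : measure_display) (T : measurableType d) (P : probability T R).

Lemma measurable_finite (F : finType) (h : T -> F) :
  (forall c, measurable (h @^-1` [set c])) ->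
  forall B : set F, measurable (h @^-1` B).
Proof.
move=> mh B.
have -> : h @^-1` B = \bigcup_(c in B) (h @^-1` [set c]).
  by apply/seteqP; split=> [x Bx|x [c Bc /= ->]//]; exists (h x).
by apply: fin_bigcup_measurable => // c _; exact: mh.
Qed.

Lemma measurable_smallest_indices k (y : 'I_m -> T -> R) :
  (forall i, measurable_fun setT (y i)) ->
  forall B : set {set 'I_m},
    measurable ((fun t => smallest_indices k (y ^~ t)) @^-1` B).
Proof.
move=> my B.
pose h t : {ffun 'I_m * 'I_m -> bool} := [ffun ij => y ij.1 t <= y ij.2 t].
pose sel (c : {ffun 'I_m * 'I_m -> bool}) : {set 'I_m} :=
  [set i in take k (sort (fun i j => c (i, j)) (enum 'I_m))]%SET.
have -> : (fun t => smallest_indices k (y ^~ t)) = sel \o h.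
  apply/funext => t; rewrite /smallest_indices /sel /=.
  suff -> : (fun i j => y i t <= y j t) = (fun i j => h t (i, j)) by [].
  by apply/funext => i; apply/funext => j; rewrite ffunE.
rewrite comp_preimage; apply: measurable_finite => c.
have -> : h @^-1` [set c] = \big[setI/setT]_(ij : 'I_m * 'I_m)
    ((fun t => y ij.1 t <= y ij.2 t) @^-1` [set c ij]).
  apply/seteqP; split=> t.
    by move=> <-; elim/big_ind: _ => //= i _; rewrite ffunE.
  move=> H; apply/ffunP => ij; rewrite ffunE.
  by move: H; rewrite (bigD1 ij) //= => -[].
apply: bigsetI_measurable => ij _.
rewrite -[X in measurable X]setTI.
by apply: measurable_fun_ler => //.
Qed.

Variables (k : nat) (f : 'I_m -> database X -> R) (g g' : 'I_m -> {RV P >-> R}).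

Definition oneshot_laplace_fun (D : database X) (t : T) :
    {set 'I_m} * m.-tuple R :=
  oneshot_output k f D (fun i => g i t) (fun i => g' i t).

Lemma measurable_oneshot_laplace_fun D :
  measurable_fun setT (oneshot_laplace_fun D).
Proof.
have mS (B : set {set 'I_m}) : measurable
    ((fun t => smallest_indices k (fun i => f i D + g i t)) @^-1` B).
  apply: (@measurable_smallest_indices k (fun i t => f i D + g i t)) => i.
  exact: measurable_funD.
apply/measurable_fun_pairP; split.
  by move=> _ B _; rewrite setTI; exact: mS.
apply/measurable_fun_tnthP => i.
rewrite (_ : _ \o _ = fun t =>
    if i \in smallest_indices k (fun i => f i D + g i t)
    then f i D + g' i t else 0); last first.
  by apply/funext => t; rewrite /= tnth_mktuple.
apply: measurable_fun_ifT => //; last exact: measurable_funD.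
move=> _ B _; rewrite setTI.
exact: (mS ((fun S : {set 'I_m} => i \in S) @^-1` B)).
Qed.

HB.instance Definition _ D := isMeasurableFun.Build _ _ _ _
  (oneshot_laplace_fun D) (measurable_oneshot_laplace_fun D).

Definition oneshot_laplace (D : database X) :
    {RV P >-> ({set 'I_m} * m.-tuple R)%type} :=
  oneshot_laplace_fun D.

End oneshot.

(* Main.v *)
From HB Require Import structures.
Require Import Defs.
From mathcomp Require Import all_boot all_order all_algebra.
From mathcomp Require Import all_classical all_reals all_analysis.
From mathcomp Require Import measurable_realfun ring lra.

(* Put L = ln (m / delta) and eta = eps / (8 sqrt (k L)); in units of lambda,
   the values of adjacent databases differ by at most eta.

   If k < 4 L, lower the selection noise of the k selected items by 2 eta and
   shift their k releases: the likelihood changes by a factor of at most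
   exp (3 k eta) <= exp eps.

   If k >= 4 L, call the largest selected item the pivot. Given the pivot j and
   its noisy value t, the other items lie before or after t independently, so
   the privacy loss is a sum of independent Bernoulli losses, of the losses of
   the k releases, and of the loss of the pivot. Its moment of order
   s = 2 L / eps is computed on the event that exactly k - 1 items lie before t:
   there each selected item can be given a factor theta = 1 - 5 s^2 eta^2 at a
   total price theta^-(k-1), and a Bernoulli(p) loss has s-th moment
   1 + O(s^2 eta^2 p), so that all m factors become at most 1. Hence, for every
   pivot, the loss exceeds eps with probability at most
     exp (- s eps + s eta + 9 k s^2 eta^2) <= exp (- L) = delta / m,
   and the sum over the m possible pivots is delta. *)

Set Implicit Arguments.
Unset Strict Implicit.
Unset Printing Implicit Defensive.

Import Order.TTheory GRing.Theory Num.Theory.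
Import numFieldNormedType.Exports.

Local Open Scope classical_set_scope.
Local Open Scope ring_scope.

(** * Laplace noise *)

(** The density is known only through its integrals over measurable sets. These make [nu] dominated
    by [mu] and determine the Radon-Nikodym derivative up to a null set, so [p] may replace it under
    the integral. *)
Lemma ge0_integral_density d (T : measurableType d) (R : realType)
    (mu : {sigma_finite_measure set T -> \bar R})
    (nu : {finite_measure set T -> \bar R}) (p : T -> R) (h : T -> \bar R) :
  measurable_fun setT p -> (forall x, 0 <= p x) ->
  (forall A, measurable A -> nu A = \int[mu]_(x in A) (p x)%:E)%E ->
  measurable_fun setT h -> (forall x, 0 <= h x)%E ->
  (\int[nu]_x h x = \int[mu]_x (h x * (p x)%:E))%E.
Proof.
move=> mp p0 nuE mh h0.
have numu : nu `<< mu.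
  apply/null_content_dominatesP => A mA A0; rewrite nuE//.
  apply: null_set_integral => //.
  exact: measurable_funTS (measurableT_comp _ _).
rewrite -(Radon_Nikodym_SigmaFinite.change_of_variables numu)//.
set g := Radon_Nikodym_SigmaFinite.f nu mu.
have ig : mu.-integrable setT g := Radon_Nikodym_SigmaFinite.f_integrable numu.
have ip : mu.-integrable setT (EFin \o p).
  apply/integrableP; split; first exact: measurableT_comp.
  under eq_integral do rewrite gee0_abs ?lee_fin//.
  by rewrite -nuE// ltey_eq fin_num_measure.
apply: ae_eq_integral => //.
- by apply: emeasurable_funM => //; exact: measurable_int ig.
- by apply: emeasurable_funM => //; exact: measurable_int ip.
- apply: ae_eqe_mul2l; apply: integral_ae_eq => //.
    exact: measurable_int ip.
  move=> A _ mA.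
  by rewrite -(Radon_Nikodym_SigmaFinite.f_integral numu)// nuE.
Qed.

Section shift.
Context {R : realType}.
Local Notation mu := (@lebesgue_measure R).

Lemma measurable_addr (c : R) : measurable_fun [set: R] (fun x => x + c).
Proof. exact: measurable_funD. Qed.

(** Translating a half-open interval keeps its length, and the values on such intervals determine
    Lebesgue measure. *)
Lemma lebesgue_measure_shift (c : R) (A : set R) : measurable A ->
  pushforward mu (fun x : measurableTypeR R => x + c : measurableTypeR R) A =
  mu A.
Proof.
pose f : measurableTypeR R -> measurableTypeR R := fun x => x + c.
have mf : measurable_fun setT f by exact: measurable_addr.
pose F : {mfun _ >-> _} := HB.pack f (isMeasurableFun.Build _ _ _ _ _ mf).
move=> mA; apply/esym/(@lebesgue_measure_unique _ (pushforward mu F)) => //.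
move=> _ [[a b]] _ <-; rewrite -[RHS]/(mu (f @^-1` `]a, b])).
have -> : f @^-1` `]a, b] = `](a - c), (b - c)]%classic.
  by apply/seteqP; split=> x /=; rewrite !in_itv/= ltrBlDr lerBrDr.
rewrite !lebesgue_measure_itv/= !lte_fin ltrD2r.
by case: ifP => // _; rewrite -!EFinB; congr EFin; ring.
Qed.

Lemma ge0_integral_shift (c : R) (h : R -> \bar R) :
  measurable_fun setT h -> (forall x, 0 <= h x)%E ->
  (\int[mu]_x h (x + c)%R = \int[mu]_x h x)%E.
Proof.
move=> mh h0.
pose f : measurableTypeR R -> measurableTypeR R := fun x => x + c.
have mf : measurable_fun setT f by exact: measurable_addr.
pose F : {mfun _ >-> _} := HB.pack f (isMeasurableFun.Build _ _ _ _ _ mf).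
transitivity (\int[pushforward mu F]_x h x)%E.
  by rewrite ge0_integral_pushforward.
by apply: eq_measure_integral => A mA _; exact: lebesgue_measure_shift.
Qed.

End shift.

Definition laplace_law (R : realType) (lambda : R) (L : probability R R) :=
  forall A : set R, measurable A ->
  L A = (\int[lebesgue_measure]_(z in A) (laplace_pdf lambda z)%:E)%E.

Section laplace_shift.
Variables (R : realType) (lambda : R) (L : probability R R).
Hypothesis lambda_gt0 : 0 < lambda.
Hypothesis LE : laplace_law lambda L.

(** This is [laplace_pdf lambda (z - v) / laplace_pdf lambda z], the likelihood ratio of noise
    translated by [v]. *)
Definition laplace_weight (v z : R) : R := expR ((`|z| - `|z - v|) / lambda).

Lemma laplace_weight_gt0 v z : 0 < laplace_weight v z.
Proof. exact: expR_gt0. Qed.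

Lemma laplace_weight0 z : laplace_weight 0 z = 1.
Proof. by rewrite /laplace_weight subr0 subrr mul0r expR0. Qed.

Lemma ln_laplace_weight v z : `|ln (laplace_weight v z)| <= `|v| / lambda.
Proof.
rewrite /laplace_weight expRK normrM (gtr0_norm (x := lambda^-1)) ?invr_gt0//.
rewrite ler_pM2r ?invr_gt0//; apply: le_trans (ler_dist_dist _ _) _.
by rewrite opprB addrC subrK.
Qed.

Lemma measurable_laplace_weight v : measurable_fun setT (laplace_weight v).
Proof.
apply: measurableT_comp => //; apply: measurable_funM => //.
apply: measurable_funB; first exact: normr_measurable.
by apply: measurableT_comp; [exact: normr_measurable|exact: measurable_addr].
Qed.

Lemma measurable_laplace_pdf : measurable_fun setT (laplace_pdf lambda).
Proof.
apply: measurable_funM => //; apply: measurableT_comp => //.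
by do !apply: measurableT_comp => //; apply: measurable_funM.
Qed.

Lemma laplace_pdf_ge0 z : 0 <= laplace_pdf lambda z.
Proof. by rewrite mulr_ge0 ?expR_ge0// invr_ge0 mulr_ge0// ltW. Qed.

Lemma laplace_shift (h : R -> \bar R) (v : R) :
  measurable_fun setT h -> (forall x, 0 <= h x)%E ->
  (\int[L]_z h (z + v)%R = \int[L]_z (h z * (laplace_weight v z)%:E))%E.
Proof.
move=> mh h0.
have dens g : measurable_fun setT g -> (forall x, 0 <= g x)%E ->
    (\int[L]_z g z = \int[lebesgue_measure]_z
      (g z * (laplace_pdf lambda z)%:E))%E.
  move=> mg g0.
  (* The identity transports [L] to [measurableTypeR R], the type that carries Lebesgue measure. *)
  have mi : measurable_fun setT (id : R -> measurableTypeR R) by [].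
  pose i : {mfun _ >-> _} := HB.pack (id : R -> measurableTypeR R)
    (isMeasurableFun.Build _ _ _ _ _ mi).
  have <- : (\int[distribution L i]_z g z = \int[L]_z g z)%E.
    exact: ge0_integral_distribution.
  apply: (@ge0_integral_density _ (measurableTypeR R)) => //.
  - exact: measurable_laplace_pdf.
  - exact: laplace_pdf_ge0.
have mw := measurable_laplace_weight v; have mp := measurable_laplace_pdf.
rewrite dens//; last first.
  by apply: measurableT_comp => //; exact: measurable_addr.
rewrite dens//; last 2 first.
- by apply: emeasurable_funM => //; exact: measurableT_comp.
- by move=> x; rewrite mule_ge0// lee_fin ltW// laplace_weight_gt0.
(* Translation invariance replaces [z] by [z + v] on the right; the weight at [z + v] then turns the
   density at [z + v] back into the density at [z]. *)
rewrite -[RHS](ge0_integral_shift v); last 2 first.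
- apply: emeasurable_funM; last exact: measurableT_comp.
  by apply: emeasurable_funM => //; exact: measurableT_comp.
- move=> x; rewrite mule_ge0// ?lee_fin ?laplace_pdf_ge0// mule_ge0//.
  by rewrite lee_fin ltW// laplace_weight_gt0.
apply: eq_integral => z _; rewrite -muleA; congr (_ * _)%E.
rewrite -EFinM; congr EFin.
rewrite /laplace_pdf /laplace_weight mulrCA addrK -expRD; congr (_ * expR _).
by rewrite mulrBl; ring.
Qed.

End laplace_shift.

(** * Product laws and resampling of coordinates *)

Section rectangles.
Variables (R : realType) (n : nat).

(** Rectangles are stable under intersection and generate the product sigma-algebra, so they
    determine a finite measure. *)
Lemma tuple_measure_unique (m1 m2 : {measure set (n.-tuple R) -> \bar R}) :
  (m1 setT < +oo)%E ->
  (forall A : 'I_n -> set R, (forall i, measurable (A i)) ->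
    m1 [set y | forall i, A i (tnth y i)] =
    m2 [set y | forall i, A i (tnth y i)]) ->
  forall B, measurable B -> m1 B = m2 B.
Proof.
move=> m1oo m12.
pose G : set (set (n.-tuple R)) := [set B | exists A : 'I_n -> set R,
  (forall i, measurable (A i)) /\ B = [set y | forall i, A i (tnth y i)]].
have mT : G setT.
  by exists (fun=> setT); split => //; apply/seteqP; split.
apply: (measure_unique G (fun=> setT)) => //.
- apply/seteqP; split.
    apply: smallest_sub; first exact: smallest_sigma_algebra.
    have : forall i : 'I_n,
        preimage_set_system setT (fun y => @tnth n R y i) measurable
        `<=` <<s G >>.
      move=> i _ [B mB <-]; apply: sub_sigma_algebra.
      (* A cylinder is the rectangle whose other sides are the whole line. *)
      exists (fun j => if j == i then B else setT); split.
        by move=> j; case: ifP.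
      apply/seteqP; split=> y /=; first by move=> [_ By] j; case: eqP => // ->.
      by move=> /(_ i); rewrite eqxx; split.
    move=> h; apply: (big_ind (fun X => X `<=` <<s G >>)) => [//||i _].
      by move=> A B hA hB X [/hA|/hB].
    exact: h.
  apply: smallest_sub; first exact: sigma_algebra_measurable.
  move=> _ [A [mA ->]].
  have -> : [set y : n.-tuple R | forall i, A i (tnth y i)] =
      \bigcap_(i in [set: 'I_n]) ((fun y => tnth y i) @^-1` A i).
    by apply/seteqP; split => y /= h i => [_|]; exact: h.
  apply: fin_bigcap_measurable => // i _.
  by rewrite -[X in measurable X]setTI; exact: measurable_tnth.
- move=> _ _ [A [mA ->]] [B [mB ->]]; exists (fun i => A i `&` B i).
  split; first by move=> i; exact: measurableI.
  by apply/seteqP; split => y /= => [[hA hB] i|h]; split => // i; case: (h i).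
- by rewrite bigcup_const//.
- by move=> _ [A [mA ->]]; exact: m12.
Qed.

End rectangles.

Definition iid_law (R : realType) (n : nat) (L : probability R R)
    (Q : probability (n.-tuple R) R) :=
  forall A : 'I_n -> set R, (forall i, measurable (A i)) ->
  Q [set y | forall i, A i (tnth y i)] = (\prod_i L (A i))%E.

Section resampling.
Variables (R : realType) (n : nat) (L : probability R R).
Variable Q : probability (n.-tuple R) R.
Hypothesis QE : iid_law L Q.

Definition upd (a : 'I_n) (z : R) (y : n.-tuple R) : n.-tuple R :=
  [tuple if i == a then z else tnth y i | i < n].

Lemma tnth_upd a z y i : tnth (upd a z y) i = if i == a then z else tnth y i.
Proof. by rewrite tnth_mktuple. Qed.

Lemma measurable_upd a :
  measurable_fun setT (fun zy : R * n.-tuple R => upd a zy.1 zy.2).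
Proof.
apply/measurable_fun_tnthP => i.
have -> : (fun y => tnth y i) \o (fun zy : R * n.-tuple R => upd a zy.1 zy.2) =
    fun zy => if i == a then zy.1 else tnth zy.2 i.
  by apply/funext => zy /=; rewrite tnth_upd.
case: (i == a); first exact: measurable_fst.
exact: (measurableT_comp (measurable_tnth i) measurable_snd).
Qed.

(** A coordinate independent of the others can be redrawn without changing the joint law. Rectangles
    suffice to check this, and Tonelli's theorem then gives the iterated integral. *)
Lemma resample a (phi : n.-tuple R -> \bar R) :
  measurable_fun setT phi -> (forall y, 0 <= phi y)%E ->
  (\int[Q]_y phi y = \int[Q]_y \int[L]_z phi (upd a z y))%E.
Proof.
move=> mphi phi0.
pose U : {mfun (R * n.-tuple R)%type >-> n.-tuple R} :=
  HB.pack (fun zy : R * n.-tuple R => upd a zy.1 zy.2)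
    (isMeasurableFun.Build _ _ _ _ _ (measurable_upd a)).
have QU B : measurable B -> Q B = pushforward (L \x Q)%E U B.
  apply: tuple_measure_unique; first by rewrite /= probability_setT ltry.
  move=> A mA; transitivity (\prod_i L (A i))%E; first exact: QE.
  (* [A'] frees side [a]: the new value must lie in [A a], while the overwritten one is
     unconstrained. *)
  pose A' i := if i == a then setT else A i.
  have mA' i : measurable (A' i) by rewrite /A'; case: ifP.
  have mrect : measurable [set y : n.-tuple R | forall i, A' i (tnth y i)].
    have -> : [set y : n.-tuple R | forall i, A' i (tnth y i)] =
        \bigcap_(i in [set: 'I_n]) ((fun y => tnth y i) @^-1` A' i).
      by apply/seteqP; split => y /= h i => [_|]; exact: h.
    apply: fin_bigcap_measurable => // i _.
    by rewrite -[X in measurable X]setTI; exact: measurable_tnth.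
  rewrite -[RHS]/((L \x Q)%E (U @^-1` [set y | forall i, A i (tnth y i)])).
  have -> : U @^-1` [set y | forall i, A i (tnth y i)] =
      A a `*` [set y | forall i, A' i (tnth y i)].
    apply/seteqP; split=> -[z y] /=.
      move=> h; split; first by have := h a; rewrite tnth_upd eqxx.
      by move=> i; have := h i; rewrite tnth_upd /A'; case: eqP.
    move=> [Az h] i; rewrite tnth_upd; have := h i; rewrite /A'.
    by case: eqP => // ->.
  rewrite product_measure1E//.
  transitivity (L (A a) * Q [set y | forall i, A' i (tnth y i)])%E => //.
  rewrite QE// (bigD1 a)//= [in RHS](bigD1 a)//=.
  rewrite {1}/A' eqxx probability_setT mul1e; congr (_ * _)%E.
  by apply: eq_bigr => i /negbTE ia; rewrite /A' ia.
transitivity (\int[pushforward (L \x Q)%E U]_y phi y)%E.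
  by apply: eq_measure_integral => B mB _; exact: QU.
rewrite ge0_integral_pushforward// -(fubini_tonelli2 (phi \o U))//.
- exact: measurableT_comp.
- by move=> x; exact: phi0.
Qed.

(** Given coordinate [b], the coordinates [e i] are independent of each other and of all that [Phi]
    reads, so each factor integrates to its conditional mean [U i]. *)
Lemma resample_prod (I : eqType) (e : I -> 'I_n) (b : 'I_n)
    (u : I -> R -> R -> R) (U : I -> R -> R) (Phi : n.-tuple R -> R)
    (r : seq I) :
  injective e -> uniq r -> (forall i, i \in r -> e i != b) ->
  (forall i z t, 0 <= u i z t) ->
  (forall i, measurable_fun setT (fun zt : R * R => u i zt.1 zt.2)) ->
  (forall i t, \int[L]_z (u i z t)%:E = (U i t)%:E)%E ->
  measurable_fun setT Phi -> (forall y, 0 <= Phi y) ->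
  (forall i z y, i \in r -> Phi (upd (e i) z y) = Phi y) ->
  (\int[Q]_y ((\prod_(i <- r) u i (tnth y (e i)) (tnth y b)) * Phi y)%:E =
   \int[Q]_y ((\prod_(i <- r) U i (tnth y b)) * Phi y)%:E)%E.
Proof.
move=> inje + + u0 mu uU.
have U0 i t : 0 <= U i t.
  by rewrite -lee_fin -uU; apply: integral_ge0 => z _; rewrite lee_fin.
have mU i : measurable_fun setT (U i).
  apply/measurable_EFinP.
  rewrite (_ : _ \o _ = fubini_G L (fun zt : R * R => (u i zt.1 zt.2)%:E)).
    apply: measurable_fun_fubini_tonelli_G; first exact/measurable_EFinP.
    by move=> zt; rewrite lee_fin.
  by apply/funext => t; rewrite /fubini_G /= uU.
have mt (c : 'I_n) := @measurable_tnth _ R n c.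
have mprod s : measurable_fun setT
    (fun y : n.-tuple R => \prod_(i <- s) u i (tnth y (e i)) (tnth y b)).
  apply: measurable_prod => i _.
  have := measurableT_comp (mu i) (_ : measurable_fun setT
    (fun y : n.-tuple R => (tnth y (e i), tnth y b))).
  by apply; apply/measurable_fun_pairP; split; exact: mt.
elim: r Phi => [|i r IH] Phi.
  by move=> *; apply: eq_integral => y _; rewrite !big_nil.
move=> /= /andP[ir ur] rb mPhi Phi0 Phii.
have ei_b : (b == e i) = false by rewrite eq_sym; apply/negbTE/rb/mem_head.
rewrite (resample (e i)); last 2 first.
- apply/measurable_EFinP; apply: measurable_funM => //; exact: mprod.
- by move=> y; rewrite lee_fin mulr_ge0// prodr_ge0.
(* Once integrated, [U i] depends on coordinate [b] alone and joins [Phi]. Since [b] is never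
   resampled, the induction hypothesis applies to their product. *)
transitivity (\int[Q]_y ((\prod_(l <- r) u l (tnth y (e l)) (tnth y b)) *
    (U i (tnth y b) * Phi y))%:E)%E; last first.
  rewrite IH//.
  - by apply: eq_integral => y _; rewrite big_cons -mulrA mulrCA.
  - by move=> l lr; apply: rb; rewrite inE lr orbT.
  - by apply: measurable_funM => //; apply: measurableT_comp => //; exact: mt.
  - by move=> y; rewrite mulr_ge0.
  - move=> l z y lr; rewrite Phii ?inE ?lr ?orbT// tnth_upd.
    case: eqP => // bl; have : e l != b by apply: rb; rewrite inE lr orbT.
    by rewrite bl eqxx.
apply: eq_integral => y _.
have E z : ((\prod_(l <- i :: r) u l (tnth (upd (e i) z y) (e l))
      (tnth (upd (e i) z y) b)) * Phi (upd (e i) z y))%:E =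
    ((\prod_(l <- r) u l (tnth y (e l)) (tnth y b) * Phi y)%:E *
    (u i z (tnth y b))%:E)%E.
  rewrite Phii ?mem_head// big_cons !tnth_upd eqxx ei_b -EFinM; congr EFin.
  rewrite (eq_big_seq (fun l => u l (tnth y (e l)) (tnth y b))).
    by rewrite -mulrA mulrC.
  move=> l lr; rewrite tnth_upd.
  by rewrite (inj_eq inje); case: eqP lr => // ->; rewrite (negbTE ir).
under eq_integral do rewrite E.
rewrite ge0_integralZl//.
- by rewrite uU -EFinM; congr EFin; rewrite -mulrA [Phi y * _]mulrC.
- apply/measurable_EFinP.
  have := measurableT_comp (mu i) (_ : measurable_fun setT
    (fun z => (z, tnth y b))).
  by apply; exact: measurable_pair2.
- by move=> z _; rewrite lee_fin.
- by rewrite lee_fin mulr_ge0// prodr_ge0.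
Qed.

End resampling.

(** * Translation of the whole noise vector *)

Section laplace_vector_shift.
Variables (R : realType) (n : nat) (lambda : R) (L : probability R R).
Variable Q : probability (n.-tuple R) R.
Hypothesis lambda_gt0 : 0 < lambda.
Hypothesis LE : laplace_law lambda L.
Hypothesis QE : iid_law L Q.

(** One coordinate is translated at a time: resampling isolates it, and the one-dimensional shift
    produces its weight. *)
Lemma laplace_vector_shift (v : 'I_n -> R) (phi : n.-tuple R -> \bar R) :
  measurable_fun setT phi -> (forall y, 0 <= phi y)%E ->
  (\int[Q]_y phi [tuple (tnth y i + v i)%R | i < n] =
   \int[Q]_y (phi y * (\prod_i laplace_weight lambda (v i) (tnth y i))%:E))%E.
Proof.
pose sh (r : seq 'I_n) y :=
  [tuple tnth y i + (if i \in r then v i else 0) | i < n].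
have msh r : measurable_fun setT (sh r).
  apply/measurable_fun_tnthP => i.
  rewrite (_ : _ \o _ = fun y => tnth y i + (if i \in r then v i else 0)).
    by apply: measurable_funD => //; exact: measurable_tnth.
  by apply/funext => y /=; rewrite tnth_mktuple.
have mw i : measurable_fun setT
    (fun y : n.-tuple R => laplace_weight lambda (v i) (tnth y i)).
  apply: measurableT_comp; first exact: measurable_laplace_weight.
  exact: measurable_tnth.
have w0 i z : 0 <= laplace_weight lambda (v i) z.
  by apply/ltW/laplace_weight_gt0.
have one a (psi : n.-tuple R -> \bar R) : measurable_fun setT psi ->
    (forall y, 0 <= psi y)%E ->
    (\int[Q]_y psi (sh [:: a] y) =
     \int[Q]_y (psi y * (laplace_weight lambda (v a) (tnth y a))%:E))%E.
  move=> mpsi psi0; rewrite (resample QE a)//; last exact: measurableT_comp.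
  rewrite [RHS](resample QE a)//; last 2 first.
  - by apply: emeasurable_funM => //; apply/measurable_EFinP.
  - by move=> y; rewrite mule_ge0// lee_fin.
  apply: eq_integral => y _.
  have mu : measurable_fun setT (fun z => psi (upd a z y)).
    apply: measurableT_comp => //.
    have := measurableT_comp (@measurable_upd R n a) (_ : measurable_fun setT
      (fun z : R => (z, y))).
    by apply; exact: measurable_pair2.
  transitivity (\int[L]_z psi (upd a (z + v a)%R y))%E.
    apply: eq_integral => z _; congr psi; apply: eq_from_tnth => i.
    by rewrite tnth_mktuple !tnth_upd inE; case: eqP => [->|]; rewrite ?addr0.
  have psi0' z : (0 <= psi (upd a z y))%E by exact: psi0.
  apply: (etrans (laplace_shift lambda_gt0 LE (v a) mu psi0')).
  by apply: eq_integral => z _; rewrite tnth_upd eqxx.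
suff main r : uniq r -> forall psi : n.-tuple R -> \bar R,
    measurable_fun setT psi -> (forall y, 0 <= psi y)%E ->
    (\int[Q]_y psi (sh r y) = \int[Q]_y (psi y *
      (\prod_(i <- r) laplace_weight lambda (v i) (tnth y i))%:E))%E.
  move=> mphi phi0; rewrite -(main _ (index_enum_uniq _))//.
  apply: eq_integral => y _; congr phi; apply: eq_from_tnth => i.
  by rewrite !tnth_mktuple mem_index_enum.
elim: r => [|a r IH] /=.
  move=> _ psi mpsi psi0; apply: eq_integral => y _.
  rewrite big_nil mule1; congr psi; apply: eq_from_tnth => i.
  by rewrite tnth_mktuple addr0.
move=> /andP[ar ur] psi mpsi psi0.
(* As [a] is not in [r], coordinate [a] is moved only once and its weight is untouched by [sh r]. *)
transitivity (\int[Q]_y (psi \o sh r) (sh [:: a] y))%E.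
  apply: eq_integral => y _ /=; congr psi; apply: eq_from_tnth => i.
  rewrite !tnth_mktuple !inE; case: (eqVneq i a) => [->|_] /=.
    by rewrite (negbTE ar) addr0.
  by rewrite addr0.
rewrite one; last 2 first.
- exact: (measurableT_comp mpsi (msh r)).
- by move=> y; exact: psi0.
transitivity (\int[Q]_y ((fun y => psi y *
    (laplace_weight lambda (v a) (tnth y a))%:E) (sh r y)))%E.
  by apply: eq_integral => y _ /=; rewrite tnth_mktuple (negbTE ar) addr0.
rewrite (IH ur (fun y =>
  psi y * (laplace_weight lambda (v a) (tnth y a))%:E)%E).
- by apply: eq_integral => y _; rewrite big_cons EFinM muleA.
- by apply: emeasurable_funM => //; apply/measurable_EFinP.
- by move=> y; rewrite mule_ge0// lee_fin.
Qed.

End laplace_vector_shift.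

(** * Selection and pivots *)

Section selection.
Variables (R : realType) (m : nat).
Implicit Types (y : 'I_m -> R) (i j l : 'I_m) (sigma : {set 'I_m}).

(** The strict total order realised by the stable sort: equal noisy values are ranked by index. *)
Definition lexlt i j (a b : R) := (a < b) || (a == b) && (i < j)%N.

Definition below y i j := lexlt i j (y i) (y j).

Lemma below_irr y i : below y i i = false.
Proof. by rewrite /below /lexlt ltxx ltnn andbF. Qed.

Lemma below_trans y : transitive (below y).
Proof.
move=> j i l; rewrite /below /lexlt => /orP[ij|/andP[/eqP-> ij]].
  move=> /orP[jl|/andP[/eqP<- _]]; last by rewrite ij.
  by rewrite (lt_trans ij jl).
by move=> /orP[->//|/andP[-> jl]]; rewrite (ltn_trans ij jl) orbT.
Qed.

Lemma belowN y i j : i != j -> ~~ below y i j = below y j i.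
Proof.
move=> ij; rewrite /below /lexlt eq_sym; case: ltgtP => //= _.
by rewrite -leqNgt leq_eqVlt eq_sym (negbTE ij : (nat_of_ord i == j) = false).
Qed.

Lemma below_asym y i j : below y i j -> below y j i = false.
Proof.
move=> ij; apply/negP => ji; have := below_trans ij ji.
by rewrite below_irr.
Qed.

(** [enum 'I_m] lists the indices in increasing order, and stability keeps that order among equal
    values, which is the tie-breaking of [below]. *)
Lemma smallest_indices_sorted y :
  sorted (below y) (sort (fun i j => y i <= y j) (enum 'I_m)).
Proof.
have tot : total (fun i j => y i <= y j) by move=> i j; exact: le_total.
have ltn_tr : transitive (fun i j : 'I_m => (i < j)%N).
  by move=> ? ? ?; exact: ltn_trans.
have := sort_stable tot ltn_tr (s := enum 'I_m).
have -> : sorted (fun i j : 'I_m => (i < j)%N) (enum 'I_m).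
  by have := iota_ltn_sorted 0 m; rewrite -val_enum_ord sorted_map.
move=> /(_ isT); apply: sub_sorted => i j /andP[yij].
rewrite /below /lexlt lt_neqAle yij andbT; case: eqVneq => //= yE.
by rewrite yE lexx.
Qed.

(** In a list sorted for [below], the entries of a prefix precede all later ones. Conversely, two
    different sets of size [k] each contain an item missing from the other, and these two items
    cannot each precede the other. *)
Lemma smallest_indicesP k y sigma : (k <= m)%N ->
  smallest_indices k y = sigma <->
  #|sigma| = k /\ forall i l, i \in sigma -> l \notin sigma -> below y i l.
Proof.
move=> km; set s := sort (fun i j => y i <= y j) (enum 'I_m).
have us : uniq s by rewrite sort_uniq enum_uniq.
have cardS : #|smallest_indices k y| = k.
  rewrite /smallest_indices cardsE (card_uniqP _) ?take_uniq//.
  by rewrite size_take size_sort size_enum_ord; case: ltngtP km.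
have lowS i l : i \in smallest_indices k y -> l \notin smallest_indices k y ->
    below y i l.
  rewrite !inE -/s => iS lS.
  have := smallest_indices_sorted y; rewrite -/s.
  rewrite (sorted_pairwise (@below_trans y)) -(cat_take_drop k s) pairwise_cat.
  move=> /andP[/allrelP + _]; apply => //.
  have : l \in s by rewrite mem_sort mem_enum.
  by rewrite -{1}(cat_take_drop k s) mem_cat (negbTE lS).
split=> [<-//|[cs low]]; apply/eqP; rewrite eqEcard cardS cs leqnn andbT.
apply/fintype.subsetP => i iS; apply: contraT => iN.
have /fintype.subsetPn[l ls lS] : ~~ (sigma \subset smallest_indices k y).
  apply: contra iN => ss; suff -> : sigma = smallest_indices k y by [].
  by apply/eqP; rewrite eqEcard ss cardS cs leqnn.
by have := below_asym (low _ _ ls iN); rewrite lowS.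
Qed.

Definition down_set y j : {set 'I_m} := [set i | (i == j) || below y i j]%SET.

Lemma down_set_inj y j j' : down_set y j = down_set y j' -> j = j'.
Proof.
move=> e; have : j \in down_set y j' by rewrite -e inE eqxx.
have : j' \in down_set y j by rewrite e inE eqxx.
rewrite !inE => /orP[/eqP//|j'j] /orP[/eqP//|jj'].
by move: (below_asym j'j); rewrite jj'.
Qed.

(** The last selected item, the pivot, is the only [j] whose down set is the selection, so the
    events over [j] are disjoint. *)
Lemma smallest_indices_pivot k y sigma : (0 < k <= m)%N -> #|sigma| = k ->
  (smallest_indices k y == sigma)%:R =
  \sum_(j in sigma) (down_set y j == sigma)%:R :> R.
Proof.
move=> /andP[k0 km] cs; case: eqP => [/smallest_indicesP|] S.
- have [_ low] := S km.
  have [j0 j0s] : exists j, j \in sigma by apply/set0Pn; rewrite -card_gt0 cs.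
  (* The maximum of [sigma] for [below] is found as the item with the largest down set. *)
  have [j js jmax] := arg_maxnP (fun j => #|down_set y j|) j0s.
  have dj : down_set y j = sigma.
    apply/finset.setP => i; rewrite inE.
    apply/idP/idP => [/orP[/eqP->//|ij]|is'].
      apply: contraT => iN; have := low _ _ js iN.
      by move=> /below_asym; rewrite ij.
    case: (eqVneq i j) => //= ij; apply: contraT; rewrite belowN// => ji.
    have : (#|down_set y j| < #|down_set y i|)%N.
      apply: proper_card; rewrite fintype.properE; apply/andP; split.
        apply/fintype.subsetP => l; rewrite !inE => /orP[/eqP->|lj].
          by rewrite ji orbT.
        by rewrite (below_trans lj ji) orbT.
      apply/fintype.subsetPn; exists i; first by rewrite inE eqxx.
      by rewrite inE (negbTE ij) /= below_asym.
    by rewrite ltnNge => /negP[]; exact: jmax.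
  rewrite (bigD1 j)//= dj eqxx big1 ?addr0// => i /andP[_ ij].
  by case: eqP => // di; move: ij; rewrite (@down_set_inj y i j) ?eqxx// di.
- rewrite big1// => j js; case: eqP => // dj; exfalso; apply: S.
  apply/smallest_indicesP => //; split => // i l.
  rewrite -dj !inE negb_or => + /andP[lj].
  rewrite belowN// => + jl; move=> /orP[/eqP->//|ij].
  exact: below_trans ij jl.
Qed.

(** Each factor compares one item with the pivot. Once the noisy value of the pivot is fixed, the
    factors involve independent noises. *)
Lemma down_set_prod y j sigma : j \in sigma ->
  (down_set y j == sigma)%:R =
  \prod_(i | i != j) ((below y i j == (i \in sigma))%:R : R).
Proof.
move=> js; case: eqP => [<-|dj].
  rewrite big1// => i ij; rewrite inE (negbTE ij) /=.
  by rewrite eqxx.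
have /existsP[i /andP[ij iN]] :
    [exists i, (i != j) && (below y i j != (i \in sigma))].
  apply: contraT; rewrite negb_exists => /forallP h; exfalso; apply: dj.
  apply/finset.setP => i; rewrite inE; have := h i; rewrite negb_and !negbK.
  by case: (eqVneq i j) => /= [->|_ /eqP].
by rewrite (bigD1 i)//= (negbTE iN) mul0r.
Qed.

End selection.

(** * Exponential tilting *)

Section tilting.
Variable R : realType.
Implicit Types a p q s u eta eps : R.

(** The bound [expR (- x) >= 1 - x] gives [expR x <= 1 / (1 - x)], and the quadratic exceeds this:
    its product with [1 - x] is [1 + x ^+ 2 / 7 * (1 - 8 * x) >= 1]. *)
Lemma expR_le_quad (x : R) : x <= 1 / 8 -> expR x <= 1 + x + 8 / 7 * x ^+ 2.
Proof.
move=> x8; have := expR_ge1Dx (- x); rewrite expRN => h.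
have e0 := expR_gt0 x.
have h1 : (1 - x) * expR x <= 1.
  by have := ler_wpM2r (ltW e0) h; rewrite mulVf ?gt_eqF.
have h2 : 1 <= (1 - x) * (1 + x + 8 / 7 * x ^+ 2).
  rewrite (_ : _ * _ = 1 + x ^+ 2 / 7 * (1 - 8 * x)); last by field.
  by rewrite lerDl mulr_ge0 ?divr_ge0 ?sqr_ge0//; lra.
have x1 : 0 < 1 - x by lra.
by rewrite -(ler_pM2l x1) (le_trans h1).
Qed.

(** If [u = ln (p / p')], then [1 - expR (- u)] is the relative change [(p - p') / p]. Expanding in
    this quantity instead of [u] makes the linear terms cancel when they are summed over the
    outcomes. *)
Lemma expRM_le_quad s eta u : 2 <= s -> eta <= 1 / 100 -> s * eta <= 1 / 8 ->
  `|u| <= eta ->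
  expR (s * u) <= 1 + s * (1 - expR (- u)) + 2 * s ^+ 2 * (1 - expR (- u)) ^+ 2.
Proof.
move=> s2 eta1 seta; rewrite ler_norml => /andP[u1 u2].
have w0 := expR_gt0 (- u); have wu := expR_ge1Dx (- u).
have uw : (1 + u) * expR (- u) <= 1.
  by rewrite -[leRHS](expRxMexpNx_1 u) ler_pM2r// expR_ge1Dx.
move: (expR (- u)) w0 wu uw => e w0 wu uw.
have su : s * u <= 1 / 8 by apply: le_trans seta; rewrite ler_pM2l//; lra.
apply: (le_trans (expR_le_quad su)).
set w := 1 - e.
have we : e = 1 - w by rewrite /w; ring.
(* [u] and [w] agree up to second order; the constants come from [|u| <= 1 / 100]. *)
have u_w : u <= w + 101 / 100 * w ^+ 2 /\ u ^+ 2 <= 103 / 100 * w ^+ 2.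
  have wle : w <= u by rewrite /w; lra.
  have hu : u * (1 - w) <= w by move: uw; rewrite we; nra.
  have [u0|u0] := leP 0 u.
    have w_0 : 0 <= w by apply: le_trans hu; rewrite mulr_ge0// -we ltW.
    have hw : u <= w * (100 / 99) by nra.
    by split; nra.
  by split; nra.
case: u_w => uw1 uw2.
have : s * u <= s * (w + 101 / 100 * w ^+ 2) by rewrite ler_pM2l//; lra.
have : s ^+ 2 * u ^+ 2 <= s ^+ 2 * (103 / 100 * w ^+ 2).
  by rewrite ler_wpM2l// sqr_ge0.
(* Since [s >= 2], the quadratic correction coming from the linear term is absorbed by a multiple of
   [s ^+ 2 * w ^+ 2]. *)
have : 2 * s * w ^+ 2 <= s ^+ 2 * w ^+ 2.
  by rewrite ler_wpM2r ?sqr_ge0// expr2 ler_wpM2r//; lra.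
rewrite exprMn; have := mulr_ge0 (sqr_ge0 s) (sqr_ge0 w).
rewrite mulrDr; lra.
Qed.

Lemma expRB1_le eta u : eta <= 1 / 100 -> `|u| <= eta ->
  `|1 - expR u| <= 102 / 100 * eta.
Proof.
move=> eta1; rewrite ler_norml => /andP[u1 u2].
have := expR_ge1Dx u; have := expR_le_quad (_ : u <= 1 / 8).
by rewrite ler_norml => /(_ ltac:(lra)) h1 h2; apply/andP; split; nra.
Qed.

(** For positive [p] and [q] this is [p * (p / q) ^ s], the contribution of an outcome with
    probabilities [p] and [q] to the exponential moment of order [s] of the privacy loss. Since [ln]
    is 0 at 0, the multiplicative lemmas ask the second probability to be positive where the first
    is. *)
Definition tilt s p q := p * expR (s * (ln p - ln q)).

Lemma tilt_ge0 s p q : 0 <= p -> 0 <= tilt s p q.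
Proof. by move=> p0; rewrite mulr_ge0// expR_ge0. Qed.

Lemma tilt0 s q : tilt s 0 q = 0. Proof. by rewrite /tilt mul0r. Qed.

Lemma tiltM s p p' q q' : 0 <= p -> 0 <= q ->
  (0 < p -> 0 < p') -> (0 < q -> 0 < q') ->
  tilt s (p * q) (p' * q') = tilt s p p' * tilt s q q'.
Proof.
rewrite !le_eqVlt => /orP[/eqP<-|p0]; first by rewrite mul0r !tilt0 mul0r.
move=> /orP[/eqP<-|q0]; first by rewrite mulr0 !tilt0 mulr0.
move=> /(_ p0) p'0 /(_ q0) q'0; rewrite /tilt !lnM//.
by rewrite mulrACA -expRD; congr (_ * expR _); ring.
Qed.

Lemma tilt_prod (I : Type) (r : seq I) (P : pred I) s (p p' : I -> R) :
  (forall i, 0 <= p i) -> (forall i, 0 < p i -> 0 < p' i) ->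
  tilt s (\prod_(i <- r | P i) p i) (\prod_(i <- r | P i) p' i) =
  \prod_(i <- r | P i) tilt s (p i) (p' i).
Proof.
move=> p0 pp'.
suff [] : [/\ tilt s (\prod_(i <- r | P i) p i) (\prod_(i <- r | P i) p' i) =
    \prod_(i <- r | P i) tilt s (p i) (p' i),
    0 <= \prod_(i <- r | P i) p i &
    (0 < \prod_(i <- r | P i) p i -> 0 < \prod_(i <- r | P i) p' i)] by [].
elim/big_rec3: _ => [|i x y z _ [<- y0 yx]].
  by split => //; rewrite /tilt subrr mulr0 expR0 mulr1.
split; [exact: tiltM (p0 i) y0 (@pp' i) yx|exact: mulr_ge0|].
rewrite lt_neqAle mulr_ge0// andbT eq_sym mulf_eq0 negb_or => /andP[a b].
by rewrite mulr_gt0// ?pp' ?yx// lt_neqAle eq_sym ?a ?b ?p0 ?y0.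
Qed.

(* Markov's inequality for the [s]-th moment of the privacy loss
   [ln (a / a')], in pointwise form. *)
Lemma le_tilt s eps a a' : 0 <= s -> 0 <= a -> 0 <= a' -> (0 < a -> 0 < a') ->
  a <= expR eps * a' + expR (- (s * eps)) * tilt s a a'.
Proof.
move=> s0; rewrite [0 <= a]le_eqVlt => /orP[/eqP<- a'0 _|a0 _ /(_ a0) a'0].
  by rewrite tilt0 mulr0 addr0 mulr_ge0// expR_ge0.
have [h|h] := leP a (expR eps * a').
  by rewrite (le_trans h)// lerDl mulr_ge0 ?expR_ge0// tilt_ge0// ltW.
suff : a <= expR (- (s * eps)) * tilt s a a'.
  by move=> /le_trans; apply; rewrite lerDr mulr_ge0 ?expR_ge0// ltW.
rewrite /tilt mulrCA -expRD ler_pMr// -[leLHS]expR0 ler_expR.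
rewrite addrC -mulrBr mulr_ge0// subr_ge0 lerBrDr.
rewrite -[X in X + _]expRK -lnM ?posrE ?expR_gt0//.
by rewrite ler_ln ?posrE ?mulr_gt0 ?expR_gt0// ltW.
Qed.

(** With [u = ln p - ln p'], [p * (1 - expR (- u))] is exactly [p - p'], which turns the
    second-order expansion into one in [p - p']. The lower bound measures what a damping factor in
    front of the tilt removes. *)
Lemma tilt_le s eta p p' : 2 <= s -> eta <= 1 / 100 -> s * eta <= 1 / 8 ->
  0 <= p -> p <= expR eta * p' -> p' <= expR eta * p ->
  [/\ tilt s p p' <=
        p + s * (p - p') + 2 * s ^+ 2 * (`|p - p'| * (102 / 100 * eta)),
      `|p - p'| <= 102 / 100 * eta * p & 7 / 8 * p <= tilt s p p'].
Proof.
move=> s2 eta1 seta; rewrite le_eqVlt => /orP[/eqP<-|p0] pp' p'p.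
  have -> : p' = 0.
    apply/le_anti/andP; split; first by rewrite (le_trans p'p)// mulr0.
    by rewrite -(pmulr_rge0 _ (expR_gt0 eta)).
  by rewrite tilt0 subrr normr0 !(mulr0, mul0r, addr0).
have p'0 : 0 < p' by rewrite -(pmulr_rgt0 _ (expR_gt0 eta)) (lt_le_trans p0).
set u := ln p - ln p'.
have ue : `|u| <= eta.
  have key a b : 0 < a -> 0 < b -> a <= expR eta * b -> ln a - ln b <= eta.
    move=> a0 b0 ab; rewrite lerBlDr -[X in X + _]expRK -lnM ?posrE ?expR_gt0//.
    by rewrite ler_ln ?posrE ?mulr_gt0 ?expR_gt0.
  by rewrite ler_norml lerNl opprB !key.
have eu : expR (- u) = p' / p.
  by rewrite opprB expRB !lnK ?posrE.
have E : p * (1 - expR (- u)) = p - p'.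
  by rewrite eu mulrBr mulr1 mulrCA mulfV ?mulr1// gt_eqF.
have B : `|p - p'| <= 102 / 100 * eta * p.
  rewrite -E normrM gtr0_norm// mulrC ler_pM2r//.
  by apply: expRB1_le => //; rewrite normrN.
split=> //.
- rewrite /tilt -/u.
  have := expRM_le_quad s2 eta1 seta ue; rewrite -(ler_pM2l p0) => /le_trans.
  apply; rewrite (_ : p * _ = p + s * (p * (1 - expR (- u))) +
    2 * s ^+ 2 * (p * (1 - expR (- u)) * (1 - expR (- u)))); last by ring.
  rewrite E lerD2l.
  rewrite ler_wpM2l//; first by rewrite mulr_ge0// sqr_ge0.
  apply: le_trans (ler_norm _) _.
  rewrite normrM ler_wpM2l//; apply: expRB1_le => //; by rewrite normrN.
- rewrite /tilt -/u mulrC ler_pM2l//; apply: le_trans (expR_ge1Dx _).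
  have : `|s * u| <= 1 / 8.
    by apply: le_trans seta; rewrite normrM ger0_norm ?ler_wpM2l//; lra.
  by rewrite ler_norml => /andP[+ _]; lra.
Qed.

(* The damping factor [1 - 5 s^2 eta^2] in front of the first term absorbs the
   second-order error because that error is at most a multiple of [p]. *)
Lemma tilt_bernoulli s eta p p' :
  2 <= s -> eta <= 1 / 100 -> s * eta <= 1 / 8 ->
  0 <= p <= 1 ->
  p <= expR eta * p' -> p' <= expR eta * p ->
  1 - p <= expR eta * (1 - p') -> 1 - p' <= expR eta * (1 - p) ->
  (1 - 5 * s ^+ 2 * eta ^+ 2) * tilt s p p' + tilt s (1 - p) (1 - p') <= 1.
Proof.
move=> s2 eta1 seta /andP[p0 p1] pp' p'p qq' q'q.
have [t1 d1 t2] := tilt_le s2 eta1 seta p0 pp' p'p.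
have q0 : 0 <= 1 - p by rewrite subr_ge0.
have [t3 d2 _] := tilt_le s2 eta1 seta q0 qq' q'q.
(* The linear terms of the two outcomes are opposite, and both second-order terms are controlled by
   the same [|p - p'|], hence by [p]. *)
have dE : `|1 - p - (1 - p')| = `|p - p'|.
  by rewrite -normrN; congr `|_|; ring.
rewrite dE in t3 d2.
have eta0 : 0 <= eta.
  rewrite leNgt; apply/negP => e0.
  have [pl|pl] := ltP 0 p; first by have := normr_ge0 (p - p'); nra.
  by have := normr_ge0 (p - p'); nra.
have h1 : s ^+ 2 * (`|p - p'| * (102 / 100 * eta)) <=
    s ^+ 2 * (102 / 100 * eta * p * (102 / 100 * eta)).
  by rewrite ler_wpM2l ?sqr_ge0// ler_wpM2r//; lra.
have h2 : 5 * s ^+ 2 * eta ^+ 2 * (7 / 8 * p) <=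
    5 * s ^+ 2 * eta ^+ 2 * tilt s p p'.
  by rewrite ler_wpM2l// (mulr_ge0 (mulr_ge0 _ (sqr_ge0 s)) (sqr_ge0 eta)).
have := mulr_ge0 (mulr_ge0 (sqr_ge0 s) (sqr_ge0 eta)) p0.
rewrite mulrBl mul1r.
move: h1 h2 t1 t3; set D := `|_|; set T1 := tilt _ _ _; set T2 := tilt _ _ _.
(* The two errors sum to [4 * (102 / 100) ^+ 2] times [s ^+ 2 * eta ^+ 2 * p], less than the
   [35 / 8] removed by the damping. *)
have -> : s ^+ 2 * (102 / 100 * eta * p * (102 / 100 * eta)) =
  (102 / 100) ^+ 2 * (s ^+ 2 * eta ^+ 2 * p) by ring.
have -> : 5 * s ^+ 2 * eta ^+ 2 * (7 / 8 * p) =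
  35 / 8 * (s ^+ 2 * eta ^+ 2 * p) by field.
by rewrite -!(mulrA 2); lra.
Qed.

(** On this range [(1 - 5 * x) * (1 + 6 * x) >= 1]. The price of the damping can thus be written as
    an exponential. *)
Lemma expR_damping (x : R) : 0 <= x <= 1 / 64 -> expR (- (6 * x)) <= 1 - 5 * x.
Proof.
move=> /andP[x0 x1]; rewrite expRN -[leLHS]mulr1 ler_pdivrMl ?expR_gt0//.
have := expR_ge1Dx (6 * x); nra.
Qed.

End tilting.

(** * The mechanism as a function of the noise vector *)

Lemma measurable_nat_of_bool d (T : measurableType d) (R : realType)
    (b : T -> bool) :
  measurable_fun setT b -> measurable_fun setT (fun t => (b t)%:R : R).
Proof.
move=> mb; rewrite (_ : (fun _ => _) = fun t => if b t then 1 else 0).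
  exact: measurable_fun_ifT.
by apply/funext => t; case: (b t).
Qed.

Lemma measurable_tilt d (T : measurableType d) (R : realType) (s : R)
    (p q : T -> R) :
  measurable_fun setT p -> measurable_fun setT q ->
  measurable_fun setT (fun t => tilt s (p t) (q t)).
Proof.
move=> mp mq; apply: measurable_funM => //.
apply: measurableT_comp => //; apply: measurable_funM => //.
by apply: measurable_funB; exact: measurableT_comp.
Qed.

Section expectation.
Context d (T : measurableType d) (R : realType) (Q : probability T R).
Implicit Types f g : T -> R.

Definition mean f : \bar R := (\int[Q]_y (f y)%:E)%E.

Definition nonneg_measurable f :=
  measurable_fun setT f /\ (forall y, 0 <= f y).

Lemma mean_ge0 f : nonneg_measurable f -> (0 <= mean f)%E.
Proof. by case=> _ f0; apply: integral_ge0 => y _; rewrite lee_fin. Qed.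

Lemma eq_mean f g : f =1 g -> mean f = mean g.
Proof. by move=> fg; apply: eq_integral => y _; rewrite fg. Qed.

Lemma le_mean f g : nonneg_measurable f -> nonneg_measurable g ->
  (forall y, f y <= g y) -> (mean f <= mean g)%E.
Proof.
move=> [mf f0] [mg g0] fg; apply: ge0_le_integral => //.
- by move=> y _; rewrite lee_fin.
- exact/measurable_EFinP.
- exact/measurable_EFinP.
- by move=> y _; rewrite lee_fin.
Qed.

Lemma mean_cst (c : R) : mean (fun=> c) = c%:E.
Proof. by rewrite /mean integral_cst//= probability_setT mule1. Qed.

Lemma meanZ (c : R) f : 0 <= c -> nonneg_measurable f ->
  mean (fun y => c * f y) = (c%:E * mean f)%E.
Proof.
move=> c0 [mf f0]; rewrite /mean -ge0_integralZl//.
- exact/measurable_EFinP.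
- by move=> y _; rewrite lee_fin.
Qed.

Lemma meanD f g : nonneg_measurable f -> nonneg_measurable g ->
  mean (fun y => f y + g y) = (mean f + mean g)%E.
Proof.
move=> [mf f0] [mg g0]; rewrite /mean -ge0_integralD//.
- by move=> y _; rewrite lee_fin.
- exact/measurable_EFinP.
- by move=> y _; rewrite lee_fin.
- exact/measurable_EFinP.
Qed.

Lemma mean_sum (I : Type) (r : seq I) (P : pred I) (F : I -> T -> R) :
  (forall i, nonneg_measurable (F i)) ->
  mean (fun y => \sum_(i <- r | P i) F i y) =
  (\sum_(i <- r | P i) mean (F i))%E.
Proof.
move=> mF; rewrite -big_filter -(ge0_integral_sum Q measurableT).
- by apply: eq_integral => y _; rewrite -big_filter sumEFin.
- by move=> i; apply/measurable_EFinP; exact: (mF i).1.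
- by move=> i y _; rewrite lee_fin; exact: (mF i).2.
Qed.

Lemma nonneg_measurableM f g : nonneg_measurable f -> nonneg_measurable g ->
  nonneg_measurable (fun y => f y * g y).
Proof.
move=> [mf f0] [mg g0]; split; first exact: measurable_funM.
by move=> y; rewrite mulr_ge0.
Qed.

Lemma nonneg_measurableD f g : nonneg_measurable f -> nonneg_measurable g ->
  nonneg_measurable (fun y => f y + g y).
Proof.
move=> [mf f0] [mg g0]; split; first exact: measurable_funD.
by move=> y; rewrite addr_ge0.
Qed.

Lemma nonneg_measurable_cst (c : R) : 0 <= c -> nonneg_measurable (fun=> c).
Proof. by move=> c0; split. Qed.

Lemma nonneg_measurable_prod (I : eqType) (r : seq I) (P : pred I)
    (F : I -> T -> R) : (forall i, nonneg_measurable (F i)) ->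
  nonneg_measurable (fun y => \prod_(i <- r | P i) F i y).
Proof.
move=> mF; split; last by move=> y; apply: prodr_ge0 => i _; exact: (mF i).2.
rewrite (_ : (fun _ => _) = fun y => \prod_(i <- [seq i <- r | P i]) F i y).
  by apply: measurable_prod => i _; exact: (mF i).1.
by apply/funext => y; rewrite big_filter.
Qed.

Lemma nonneg_measurable_sum (I : Type) (r : seq I) (P : pred I)
    (F : I -> T -> R) : (forall i, nonneg_measurable (F i)) ->
  nonneg_measurable (fun y => \sum_(i <- r | P i) F i y).
Proof.
move=> mF; split; last by move=> y; apply: sumr_ge0 => i _; exact: (mF i).2.
rewrite (_ : (fun _ => _) = fun y => \sum_(i <- [seq i <- r | P i]) F i y).
  by apply: measurable_sum => i; exact: (mF i).1.
by apply/funext => y; rewrite big_filter.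
Qed.

End expectation.

Lemma nonneg_measurable_comp d (T : measurableType d) d' (U : measurableType d')
    (R : realType) (f : U -> R) (h : T -> U) :
  nonneg_measurable f -> measurable_fun setT h ->
  nonneg_measurable (fun t => f (h t)).
Proof. by move=> [mf f0] mh; split => //; exact: measurableT_comp. Qed.

Section laplace_weight_moment.
Variables (R : realType) (lambda : R) (L : probability R R).
Hypothesis lambda_gt0 : 0 < lambda.
Hypothesis LE : laplace_law lambda L.

Lemma nonneg_laplace_weight v : nonneg_measurable (laplace_weight lambda v).
Proof.
split; first exact: measurable_laplace_weight.
by move=> z; exact/ltW/laplace_weight_gt0.
Qed.

Lemma nonneg_tilt_weight s v :
  nonneg_measurable (fun z => tilt s 1 (laplace_weight lambda v z)).
Proof.
split; last by move=> z; exact: tilt_ge0.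
by apply: measurable_tilt => //; exact: measurable_laplace_weight.
Qed.

Lemma laplace_weight_le v eta z :
  `|v| / lambda <= eta -> laplace_weight lambda v z <= expR eta.
Proof.
move=> ve; rewrite -[leLHS]lnK ?posrE ?laplace_weight_gt0// ler_expR.
apply: le_trans ve; apply: le_trans (ln_laplace_weight lambda_gt0 v z).
exact: ler_norm.
Qed.

Lemma tilt_weight_le s v eta z : 0 <= s ->
  `|v| / lambda <= eta ->
  tilt s 1 (laplace_weight lambda v z) <= expR (s * eta).
Proof.
move=> s0 ve; rewrite /tilt mul1r ler_expR ler_wpM2l// ln1 sub0r.
apply: le_trans ve; apply: le_trans (ln_laplace_weight lambda_gt0 v z).
by rewrite -normrN ler_norm.
Qed.

Lemma mean_laplace_weight v : mean L (laplace_weight lambda v) = 1%E.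
Proof.
have := laplace_shift lambda_gt0 LE v (measurable_cst (1%E : \bar R)).
rewrite integral_cst//= probability_setT mule1 => -> //.
by apply: eq_integral => z _; rewrite mul1e.
Qed.

Lemma mean_laplace_shift (h : R -> R) v : nonneg_measurable h ->
  mean L (fun z => h (z + v)) =
  mean L (fun z => h z * laplace_weight lambda v z).
Proof.
move=> [mh h0].
have := @laplace_shift _ _ _ lambda_gt0 LE (EFin \o h) v.
apply; last by move=> x /=; rewrite lee_fin.
exact/measurable_EFinP.
Qed.

(** The weight [w] has mean 1, so the linear term [s * (1 - w)] in the expansion of [w ^ (- s)]
    integrates to zero and only the second order remains. *)
Lemma laplace_weight_moment s eta v :
  2 <= s -> eta <= 1 / 100 -> s * eta <= 1 / 8 -> `|v| / lambda <= eta ->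
  (mean L (fun z => tilt s 1 (laplace_weight lambda v z)) <=
    (1 + 3 * (s ^+ 2 * eta ^+ 2))%:E)%E.
Proof.
move=> s2 eta1 seta ve.
have s0 : 0 <= s by lra.
set w := laplace_weight lambda v.
(* The term [s * w z] is moved to the left so that only nonnegative functions are integrated. *)
have pt z : tilt s 1 (w z) + s * w z <= 1 + 3 * (s ^+ 2 * eta ^+ 2) + s.
  have ue : `|- ln (w z)| <= eta.
    by rewrite normrN (le_trans (ln_laplace_weight lambda_gt0 v z)).
  have := expRM_le_quad s2 eta1 seta ue; have := expRB1_le eta1 (u := ln (w z)).
  rewrite -normrN => /(_ ue).
  rewrite /tilt mul1r ln1 sub0r opprK lnK ?posrE ?laplace_weight_gt0// => h1 h2.
  have : (1 - w z) ^+ 2 <= (102 / 100 * eta) ^+ 2.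
    rewrite -[leLHS]real_normK ?num_real// lerXn2r ?nnegrE//.
    by apply: le_trans h1.
  move=> /(ler_wpM2l (sqr_ge0 s)) h3.
  have := mulr_ge0 (sqr_ge0 s) (sqr_ge0 eta).
  move: h3; rewrite exprMn mulrCA; move: h2.
  by rewrite -(mulrA 2) mulrBr; lra.
have mw := nonneg_laplace_weight v; have mt := nonneg_tilt_weight s v.
have msw : nonneg_measurable (fun z => s * w z).
  exact: nonneg_measurableM (nonneg_measurable_cst _ s0) mw.
have c0 : 0 <= 1 + 3 * (s ^+ 2 * eta ^+ 2) + s.
  rewrite addr_ge0// addr_ge0// mulr_ge0//.
  exact: mulr_ge0 (sqr_ge0 s) (sqr_ge0 eta).
have : (mean L (fun z => tilt s 1 (w z)) + s%:E <=
    (1 + 3 * (s ^+ 2 * eta ^+ 2))%:E + s%:E)%E.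
  rewrite -EFinD -[leRHS](mean_cst L).
  have -> : s%:E = mean L (fun z => s * w z).
    by rewrite meanZ// mean_laplace_weight mule1.
  rewrite -meanD//; apply: le_mean pt; first exact: nonneg_measurableD.
  exact: nonneg_measurable_cst.
by rewrite leeD2rE.
Qed.

End laplace_weight_moment.

Section mechanism.
Variables (R : realType) (m k : nat) (lambda : R) (L : probability R R).
Variable Q : probability ((m + m).-tuple R) R.
Hypothesis lambda_gt0 : 0 < lambda.
Hypothesis LE : laplace_law lambda L.
Hypothesis QE : iid_law L Q.
Hypothesis hk : (0 < k <= m)%N.
Variable S0 : set ({set 'I_m} * m.-tuple R).
Hypothesis mS0 : measurable S0.
Implicit Types (x : 'I_m -> R) (y : (m + m).-tuple R) (sigma : {set 'I_m}).

Definition sel_noise y i := tnth y (lshift m i).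
Definition val_noise y i := tnth y (rshift m i).

Definition selected x y := smallest_indices k (fun i => x i + sel_noise y i).

(** [sigma] is a parameter rather than the selected set: for fixed [sigma] the release reads only
    the fresh noise, which is independent of the selection. *)
Definition released sigma x y : m.-tuple R :=
  [tuple if i \in sigma then x i + val_noise y i else 0 | i < m].

Definition hit sigma x y : R := \1_(xsection S0 sigma) (released sigma x y).

Lemma measurable_sel_noise i : measurable_fun setT (sel_noise ^~ i).
Proof. exact: measurable_tnth. Qed.

Lemma measurable_val_noise i : measurable_fun setT (val_noise ^~ i).
Proof. exact: measurable_tnth. Qed.

Lemma nonneg_hit sigma x : nonneg_measurable (hit sigma x).
Proof.
split; last by move=> y; rewrite /hit indicE.
apply: measurableT_comp.
  exact/measurable_indic/measurable_xsection.
apply/measurable_fun_tnthP => i.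
rewrite (_ : _ \o _ = fun y => if i \in sigma then x i + val_noise y i else 0).
  case: (i \in sigma) => //; apply: measurable_funD => //.
  exact: measurable_val_noise.
by apply/funext => y; rewrite /= tnth_mktuple.
Qed.

Lemma nonneg_selected sigma x :
  nonneg_measurable (fun y => (selected x y == sigma)%:R : R).
Proof.
split; last by move=> y.
apply: measurable_nat_of_bool => _ B _; rewrite setTI.
apply: (@measurable_smallest_indices _ _ _ _ k (fun i y => x i + sel_noise y i)
  _ ((fun tau : {set 'I_m} => tau == sigma) @^-1` B)) => i.
by apply: measurable_funD => //; exact: measurable_sel_noise.
Qed.

Definition output_event x : set ((m + m).-tuple R) :=
  [set y | S0 (selected x y, released (selected x y) x y)].

(** Splitting by the selected set separates the selection, which reads the first [m] noises, from
    the release, which reads the last [m]. *)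
Lemma output_mean x :
  Q (output_event x) =
  (\sum_(sigma : {set 'I_m} | #|sigma| == k)
    mean Q (fun y => (selected x y == sigma)%:R * hit sigma x y)%R)%E.
Proof.
set E := output_event x.
have EE y : \1_E y = \sum_(sigma : {set 'I_m} | #|sigma| == k)
    (selected x y == sigma)%:R * hit sigma x y.
  have km : (k <= m)%N by case/andP: hk.
  have [cs _] := (smallest_indicesP (fun i => x i + sel_noise y i)
    (selected x y) km).1 erefl.
  rewrite (bigD1 (selected x y))/=; last by rewrite cs.
  rewrite eqxx mul1r big1 ?addr0; last first.
    by move=> sigma /andP[_]; rewrite eq_sym => /negbTE ->; rewrite mul0r.
  rewrite /hit !indicE; congr (nat_of_bool _)%:R.
  by apply/idP/idP; rewrite !inE/= /E/output_event/xsection/= ?inE.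
have n1 sigma : nonneg_measurable
    (fun y => (selected x y == sigma)%:R * hit sigma x y).
  by apply: nonneg_measurableM; [exact: nonneg_selected|exact: nonneg_hit].
rewrite -mean_sum//.
have mE : measurable E.
  apply/(measurable_indicP R).
  have -> : \1_E = fun y => \sum_(sigma : {set 'I_m} | #|sigma| == k)
      (selected x y == sigma)%:R * hit sigma x y by exact/funext.
  exact: (nonneg_measurable_sum _ _ n1).1.
rewrite -[LHS]/(Q E) -(setIT E) -integral_indic//.
by apply: eq_integral => y _; rewrite EE.
Qed.

Definition pair_vector (T : Type) (a b : 'I_m -> T) (i : 'I_(m + m)) : T :=
  match fintype.split i with inl j => a j | inr j => b j end.

Lemma pair_vector_lshift (T : Type) (a b : 'I_m -> T) i :
  pair_vector a b (lshift m i) = a i.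
Proof. by rewrite /pair_vector (unsplitK (inl i)). Qed.

Lemma pair_vector_rshift (T : Type) (a b : 'I_m -> T) i :
  pair_vector a b (rshift m i) = b i.
Proof. by rewrite /pair_vector (unsplitK (inr i)). Qed.

Definition shifted (a b : 'I_m -> R) y : (m + m).-tuple R :=
  [tuple tnth y i + pair_vector a b i | i < m + m].

Lemma sel_noise_shifted a b y i :
  sel_noise (shifted a b y) i = sel_noise y i + a i.
Proof. by rewrite /sel_noise tnth_mktuple pair_vector_lshift. Qed.

Lemma val_noise_shifted a b y i :
  val_noise (shifted a b y) i = val_noise y i + b i.
Proof. by rewrite /val_noise tnth_mktuple pair_vector_rshift. Qed.

Definition shift_weight (a b : 'I_m -> R) y : R :=
  (\prod_i laplace_weight lambda (a i) (sel_noise y i)) *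
  (\prod_i laplace_weight lambda (b i) (val_noise y i)).

Lemma nonneg_shift_weight a b : nonneg_measurable (shift_weight a b).
Proof.
apply: nonneg_measurableM; apply: nonneg_measurable_prod => i.
  apply: nonneg_measurable_comp (measurable_sel_noise i).
  exact: nonneg_laplace_weight.
apply: nonneg_measurable_comp (measurable_val_noise i).
exact: nonneg_laplace_weight.
Qed.

Lemma mean_shifted a b (phi : (m + m).-tuple R -> R) : nonneg_measurable phi ->
  mean Q (fun y => phi (shifted a b y)) =
  mean Q (fun y => phi y * shift_weight a b y).
Proof.
move=> [mphi phi0].
transitivity (\int[Q]_y ((EFin \o phi)
  [tuple (tnth y i + pair_vector a b i)%R | i < m + m]))%E => //.
rewrite (laplace_vector_shift lambda_gt0 LE QE); last 2 first.
- exact/measurable_EFinP.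
- by move=> y /=; rewrite lee_fin.
apply: eq_integral => y _ /=; rewrite -EFinM; congr (_ * _)%:E.
rewrite big_split_ord; congr (_ * _); apply: eq_bigr => i _.
  by rewrite pair_vector_lshift.
by rewrite pair_vector_rshift.
Qed.

Lemma prod_if_const sigma (F : 'I_m -> R) (c : R) : #|sigma| = k ->
  (forall i, 0 <= F i) -> (forall i, F i <= if i \in sigma then c else 1) ->
  \prod_i F i <= c ^+ k.
Proof.
move=> cs F0 Fc; apply: (@le_trans _ _ (\prod_i if i \in sigma then c else 1)).
  by apply: ler_prod => i _; rewrite F0 Fc.
by rewrite -big_mkcond/= prodr_const cs.
Qed.

(* The noisy values move by at most [c], so lowering the noise of the selected
   items by [2 * c] keeps them below all the others. *)
Lemma selected_shift c x x' sigma a b y : (forall i, `|x i - x' i| <= c) ->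
  (forall i, a i = if i \in sigma then - (2 * c) else 0) ->
  selected x y = sigma -> selected x' (shifted a b y) = sigma.
Proof.
move=> xc aE /smallest_indicesP.
have km : (k <= m)%N by case/andP: hk.
move=> /(_ km) [cs low]; apply/smallest_indicesP => //; split=> // i l iS lS.
have := low i l iS lS.
rewrite /below /lexlt !sel_noise_shifted !aE iS (negbTE lS).
have := xc i; have := xc l; rewrite !ler_norml => /andP[l1 l2] /andP[i1 i2].
move=> /orP[il|/andP[/eqP il ->]]; first by apply/orP; left; lra.
by rewrite andbT orbC -le_eqVlt; lra.
Qed.

(** The shifted noise reproduces under [x'] the selection and the releases obtained under [x]. Each
    of the [k] selected items pays [2 * c / lambda] for the selection and [c / lambda] for the
    release; the others are not shifted. *)
Lemma pure_selection_bound c x x' sigma : (forall i, `|x i - x' i| <= c) ->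
  #|sigma| = k ->
  (mean Q (fun y => (selected x y == sigma)%:R * hit sigma x y)%R <=
   (expR (3 * k%:R * (c / lambda)))%:E *
   mean Q (fun y => (selected x' y == sigma)%:R * hit sigma x' y)%R)%E.
Proof.
move=> xc cs.
have c0 : 0 <= c.
  by have /andP[k0 km] := hk; apply: le_trans (xc (Ordinal (leq_trans k0 km))).
pose a i := if i \in sigma then - (2 * c) else 0.
pose b i := if i \in sigma then x i - x' i else 0.
pose F x y := (selected x y == sigma)%:R * hit sigma x y.
have nF z : nonneg_measurable (F z).
  by apply: nonneg_measurableM; [exact: nonneg_selected|exact: nonneg_hit].
have nW := nonneg_shift_weight a b.
have msh : measurable_fun setT (shifted a b).
  apply/measurable_fun_tnthP => i.
  rewrite (_ : _ \o _ = fun y => tnth y i + pair_vector a b i).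
    by apply: measurable_funD => //; exact: measurable_tnth.
  by apply/funext => y; rewrite /= tnth_mktuple.
apply: (@le_trans _ _ (mean Q (fun y => F x' (shifted a b y)))).
  apply: (le_mean Q (nF x) (nonneg_measurable_comp (nF x') msh)) => y.
  rewrite /F; case: eqP => [sy|_]; last first.
    by rewrite mul0r; exact: (nonneg_measurable_comp (nF x') msh).2.
  rewrite (@selected_shift c x x' sigma) ?eqxx// !mul1r.
  suff E : released sigma x' (shifted a b y) = released sigma x y.
    by rewrite /hit E.
  apply: eq_from_tnth => i; rewrite !tnth_mktuple val_noise_shifted /b.
  by case: (i \in sigma) => //; ring.
rewrite mean_shifted// -(meanZ Q (expR_ge0 _) (nF x')).
apply: (le_mean Q (nonneg_measurableM (nF x') nW) (nonneg_measurableM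
  (nonneg_measurable_cst _ (expR_ge0 _)) (nF x'))) => y.
 rewrite mulrC; apply: ler_wpM2r; first exact: (nF x').2.
have -> : expR (3 * k%:R * (c / lambda)) =
    expR (2 * c / lambda) ^+ k * expR (c / lambda) ^+ k.
  by rewrite -!expRM_natl -expRD; congr expR; ring.
have w0 v z : 0 <= laplace_weight lambda v z := (nonneg_laplace_weight _ v).2 z.
apply: ler_pM; try exact: prodr_ge0.
  apply: (prod_if_const cs) => // i; rewrite /a; case: ifP => _.
    by apply: laplace_weight_le => //; rewrite normrN ger0_norm// mulr_ge0.
  by rewrite laplace_weight0.
apply: (prod_if_const cs) => // i; rewrite /b; case: ifP => _.
  by apply: laplace_weight_le => //; rewrite ler_pM2r// invr_gt0.
by rewrite laplace_weight0.
Qed.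

End mechanism.

(** * Conditioning on the pivot *)

Section pivot.
Variables (R : realType) (m k : nat) (lambda : R) (L : probability R R).
Variable Q : probability ((m + m).-tuple R) R.
Hypothesis lambda_gt0 : 0 < lambda.
Hypothesis LE : laplace_law lambda L.
Hypothesis QE : iid_law L Q.
Hypothesis hk : (0 < k <= m)%N.
Variable S0 : set ({set 'I_m} * m.-tuple R).
Hypothesis mS0 : measurable S0.
Implicit Types (x : 'I_m -> R) (y : (m + m).-tuple R) (sigma : {set 'I_m}).

Lemma nonneg_lexlt x i j (b : bool) : nonneg_measurable
  (fun zt : R * R => (lexlt i j (x i + zt.1) zt.2 == b)%:R : R).
Proof.
split; last by move=> zt.
apply: measurable_nat_of_bool.
have m1 : measurable_fun setT (fun zt : R * R => x i + zt.1).
  by apply: measurable_funD => //; exact: measurable_fst.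
have m2 : measurable_fun setT (fun zt : R * R => zt.2) by exact: measurable_snd.
have ml : measurable_fun setT (fun zt : R * R => lexlt i j (x i + zt.1) zt.2).
  apply: measurable_or; first exact: measurable_fun_ltr.
  by apply: measurable_and => //; exact: measurable_fun_eqr.
have -> : (fun zt : R * R => lexlt i j (x i + zt.1) zt.2 == b) =
    fun zt => if lexlt i j (x i + zt.1) zt.2 then b else ~~ b.
  by apply/funext => zt; case: lexlt; case: b.
exact: measurable_fun_ifT.
Qed.

Lemma nonneg_lexlt_left x i j (b : bool) t : nonneg_measurable
  (fun z : R => (lexlt i j (x i + z) t == b)%:R : R).
Proof.
apply: (nonneg_measurable_comp (nonneg_lexlt x i j b) (h := fun z => (z, t))).
exact: measurable_pair2.
Qed.

(* [b = true] is the side on which item [i] precedes a pivot [j] whose noisy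
   value is [t]. *)
Definition side_prob x i j (b : bool) t : R :=
  fine (mean L (fun z => (lexlt i j (x i + z) t == b)%:R)).

Lemma side_probE x i j b t :
  mean L (fun z => (lexlt i j (x i + z) t == b)%:R) = (side_prob x i j b t)%:E.
Proof.
rewrite fineK// ge0_fin_numE ?(mean_ge0 _ (nonneg_lexlt_left _ _ _ _ _))//.
apply: (@le_lt_trans _ _ (mean L (fun=> 1))); last by rewrite mean_cst ltry.
apply: (le_mean L (nonneg_lexlt_left _ _ _ _ _)).
  exact: nonneg_measurable_cst.
by move=> z; rewrite lern1 leq_b1.
Qed.

Lemma side_prob_ge0 x i j b t : 0 <= side_prob x i j b t.
Proof.
by rewrite -lee_fin -side_probE mean_ge0//; exact: nonneg_lexlt_left.
Qed.

Lemma side_prob_compl x i j t :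
  side_prob x i j false t = 1 - side_prob x i j true t.
Proof.
apply/eqP; rewrite eq_sym subr_eq -eqe EFinD -!side_probE.
rewrite -meanD; try exact: nonneg_lexlt_left.
rewrite -(mean_cst L); apply/eqP/eq_mean => z.
by case: lexlt; rewrite ?addr0 ?add0r.
Qed.

Lemma nonneg_side_prob x i j b : nonneg_measurable (side_prob x i j b).
Proof.
split; last exact: side_prob_ge0.
apply/measurable_EFinP.
rewrite (_ : _ \o _ = fubini_G L
    (fun zt : R * R => ((lexlt i j (x i + zt.1) zt.2 == b)%:R)%:E)).
  apply: measurable_fun_fubini_tonelli_G; last by move=> zt; rewrite lee_fin.
  by apply/measurable_EFinP; exact: (nonneg_lexlt x i j b).1.
by apply/funext => t; rewrite /fubini_G /= -side_probE.
Qed.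

(** As [x i + z] equals [x' i + (z + (x i - x' i))], the change of database is a translation of the
    noise, whose weight is bounded pointwise. *)
Lemma side_prob_ratio x x' i j b t eta : `|x i - x' i| / lambda <= eta ->
  side_prob x i j b t <= expR eta * side_prob x' i j b t.
Proof.
move=> xe; rewrite -lee_fin EFinM -!side_probE.
pose h z : R := (lexlt i j (x' i + z) t == b)%:R.
have nh : nonneg_measurable h by exact: nonneg_lexlt_left.
have -> : mean L (fun z => (lexlt i j (x i + z) t == b)%:R) =
    mean L (fun z => h (z + (x i - x' i))).
  apply: eq_mean => z; rewrite /h; congr (lexlt _ _ _ _ == _)%:R; ring.
rewrite (mean_laplace_shift lambda_gt0 LE)// -(meanZ L (expR_ge0 _) nh).
have nw := nonneg_laplace_weight lambda (x i - x' i).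
apply: (le_mean L (nonneg_measurableM nh nw)
  (nonneg_measurableM (nonneg_measurable_cst _ (expR_ge0 _)) nh)) => z.
by rewrite mulrC ler_wpM2r ?(nh.2)// laplace_weight_le.
Qed.

(** For [j] in [sigma], the conditional probability that [sigma] is selected with pivot [j], given
    that [j] has noisy value [t]. *)
Definition pivot_prob sigma j x t :=
  \prod_(i | i != j) side_prob x i j (i \in sigma) t.

Lemma nonneg_pivot_prob sigma j x : nonneg_measurable (pivot_prob sigma j x).
Proof. by apply: nonneg_measurable_prod => i; exact: nonneg_side_prob. Qed.

Lemma measurable_pivot_level x j : measurable_fun setT
  (fun y => x j + sel_noise y j : R).
Proof. by apply: measurable_funD => //; exact: measurable_sel_noise. Qed.

Lemma nonneg_pivot_level (F : R -> R) x j : nonneg_measurable F ->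
  nonneg_measurable (fun y => F (x j + sel_noise y j)).
Proof.
by move=> nF; exact: nonneg_measurable_comp (measurable_pivot_level x j).
Qed.

(** For each pivot, the selection noises of the other items are integrated out: given the level of
    the pivot they are independent, and the release does not read them. *)
Lemma mean_selected_pivot sigma x : #|sigma| = k ->
  mean Q (fun y => (selected k x y == sigma)%:R * hit S0 sigma x y) =
  (\sum_(j in sigma) mean Q (fun y =>
     (pivot_prob sigma j x (x j + sel_noise y j) * hit S0 sigma x y)%R))%E.
Proof.
move=> cs; have nh := nonneg_hit mS0 sigma x.
pose F j y : R := \prod_(i <- [seq i <- index_enum 'I_m | i != j])
  (lexlt i j (x i + tnth y (lshift m i)) (x j + tnth y (lshift m j))
    == (i \in sigma))%:R.
have nF j : nonneg_measurable (F j).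
  apply: nonneg_measurable_prod => i.
  apply: (nonneg_measurable_comp (nonneg_lexlt x i j (i \in sigma))
    (h := fun y => (tnth y (lshift m i), x j + tnth y (lshift m j)))).
  apply/measurable_fun_pairP; split; first exact: measurable_tnth.
  exact: measurable_pivot_level.
transitivity (mean Q (fun y => \sum_(j in sigma) F j y * hit S0 sigma x y)).
  apply: eq_mean => y; rewrite /selected smallest_indices_pivot// mulr_suml.
  apply: eq_bigr => j js; rewrite down_set_prod// /F big_filter.
  by congr (_ * _).
rewrite mean_sum; last by move=> j; exact: nonneg_measurableM.
apply: eq_bigr => j js.
have := @resample_prod _ _ L Q QE 'I_m (lshift m) (lshift m j)
  (fun i z t => (lexlt i j (x i + z) (x j + t) == (i \in sigma))%:R)
  (fun i t => side_prob x i j (i \in sigma) (x j + t))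
  (hit S0 sigma x) [seq i <- index_enum 'I_m | i != j].
rewrite /mean => ->.
- by apply: eq_integral => y _; rewrite /pivot_prob big_filter.
- exact: lshift_inj.
- exact: filter_uniq (index_enum_uniq _).
- by move=> i; rewrite mem_filter (inj_eq (@lshift_inj _ _)) => /andP[].
- by [].
- move=> i.
  apply: (nonneg_measurable_comp (nonneg_lexlt x i j (i \in sigma))
    (h := fun zt : R * R => (zt.1, x j + zt.2)) _).1.
  apply/measurable_fun_pairP; split; first exact: measurable_fst.
  by apply: measurable_funD => //; exact: measurable_snd.
- by move=> i t; rewrite -side_probE.
- exact: nh.1.
- exact: nh.2.
- move=> i z y _; rewrite /hit; congr (\1_ _ _); apply: eq_from_tnth => l.
  by rewrite !tnth_mktuple /val_noise tnth_upd eq_rlshift.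
Qed.

Definition pivot_tilt (s : R) sigma j x x' t :=
  \prod_(i | i != j)
    tilt s (side_prob x i j (i \in sigma) t) (side_prob x' i j (i \in sigma) t).

Lemma nonneg_pivot_tilt s sigma j x x' :
  nonneg_measurable (pivot_tilt s sigma j x x').
Proof.
apply: nonneg_measurable_prod => i; split.
  apply: measurable_tilt; exact: (nonneg_side_prob _ _ _ _).1.
by move=> t; exact/tilt_ge0/side_prob_ge0.
Qed.

(** Over all subsets, the sum of the products is the product of the sums. With a damping factor on
    each selected item other than the pivot, every sum is at most 1 by [tilt_bernoulli], and the
    cardinality [k] fixes the total price of the damping. *)
Lemma pivot_tilt_sum (s eta : R) j x x' t :
  2 <= s -> eta <= 1 / 100 -> 0 <= eta -> s * eta <= 1 / 8 ->
  (forall i, `|x i - x' i| / lambda <= eta) ->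
  \sum_(sigma : {set 'I_m} | (#|sigma| == k) && (j \in sigma))
    pivot_tilt s sigma j x x' t <= expR (6 * (s ^+ 2 * eta ^+ 2) * k%:R).
Proof.
move=> s2 eta1 eta0 seta xe.
set v := s ^+ 2 * eta ^+ 2.
have v0 : 0 <= v by rewrite mulr_ge0// sqr_ge0.
have v64 : v <= 1 / 64.
  rewrite /v -exprMn (_ : 1 / 64 = (1 / 8) ^+ 2); last by field.
  by rewrite lerXn2r// nnegrE mulr_ge0//; lra.
pose theta := 1 - 5 * v.
have th0 : 0 < theta by rewrite /theta; lra.
have th1 : theta <= 1 by rewrite /theta; lra.
have xe' i : `|x' i - x i| / lambda <= eta by rewrite distrC.
(* The values 1 and 0 at [j] force the pivot into [sigma]. *)
pose F i := if i == j then 1 else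
  theta * tilt s (side_prob x i j true t) (side_prob x' i j true t).
pose G i := if i == j then 0 else
  tilt s (side_prob x i j false t) (side_prob x' i j false t).
have F0 i : 0 <= F i.
  rewrite /F; case: eqP => // _.
  by rewrite mulr_ge0 ?tilt_ge0 ?side_prob_ge0// ltW.
have G0 i : 0 <= G i.
  by rewrite /G; case: eqP => // _; rewrite tilt_ge0 ?side_prob_ge0.
have FG i : F i + G i <= 1.
  rewrite /F /G; case: eqP => _; first by rewrite addr0.
  rewrite !side_prob_compl /theta /v mulrA; apply: tilt_bernoulli => //.
  - by rewrite side_prob_ge0 -subr_ge0 -side_prob_compl side_prob_ge0.
  - exact: side_prob_ratio.
  - exact: side_prob_ratio.
  - by rewrite -!side_prob_compl; exact: side_prob_ratio.
  - by rewrite -!side_prob_compl; exact: side_prob_ratio.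
have prodE sigma : #|sigma| = k -> j \in sigma ->
    theta ^+ k.-1 * pivot_tilt s sigma j x x' t =
    \prod_i (if i \in sigma then F i else G i).
  move=> cs js; rewrite [RHS](bigD1 j)//= js {1}/F eqxx mul1r.
  have -> : theta ^+ k.-1 =
      \prod_(i | i != j) (if i \in sigma then theta else 1).
    rewrite -big_mkcondr/= prodr_const; congr (_ ^+ _).
    rewrite -cs (cardsD1 j) js/= -(cardsE [pred i | _]); apply: eq_card => i.
    by rewrite !inE.
  rewrite -big_split/=; apply: eq_bigr => i /negbTE ij; rewrite /F /G ij.
  by case: (i \in sigma); rewrite ?mul1r.
have sum_le : \sum_(sigma : {set 'I_m} | (#|sigma| == k) && (j \in sigma))
    theta ^+ k.-1 * pivot_tilt s sigma j x x' t <= 1.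
  rewrite (eq_bigr (fun sigma : {set 'I_m} =>
      \prod_i (if i \in sigma then F i else G i))); last first.
    by move=> sigma /andP[/eqP cs js]; exact: prodE.
  apply: (@le_trans _ _ (\prod_i (F i + G i))); last first.
    apply: (@le_trans _ _ (\prod_(i < m) 1)); last by rewrite big1_eq.
    by apply: ler_prod => i _; rewrite addr_ge0 ?F0 ?FG.
  (* Extending the sum to all subsets only adds nonnegative terms. *)
  rewrite bigA_distr big_mkcond; apply: ler_sum => sigma _.
  case: ifP => _; rewrite ?lexx//; apply: prodr_ge0 => i _; case: ifP => _ //.
rewrite -mulr_sumr in sum_le.
(* The pivot carries no damping, hence the exponent [k.-1]; since [theta <= 1], passing to exponent
   [k] only lowers the power. *)
have th_lower : expR (- (6 * v * k%:R)) <= theta ^+ k.-1.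
  apply: (@le_trans _ _ (expR (- (6 * v)) ^+ k)).
    by rewrite -expRM_natr mulNr.
  apply: (@le_trans _ _ (theta ^+ k)).
    rewrite lerXn2r ?nnegrE ?expR_ge0 ?(ltW th0)//.
    by apply: expR_damping; apply/andP.
  by rewrite ler_wiXn2l ?leq_pred ?(ltW th0).
have S0' : 0 <= \sum_(sigma : {set 'I_m} | (#|sigma| == k) && (j \in sigma))
    pivot_tilt s sigma j x x' t.
  by apply: sumr_ge0 => sigma _; exact: (nonneg_pivot_tilt _ _ _ _ _).2.
rewrite -[leRHS]mulr1 -ler_pdivrMl ?expR_gt0// -expRN.
by apply: le_trans sum_le; rewrite ler_wpM2r.
Qed.

End pivot.

(** * The approximate privacy bound by moments *)

Section approximate.
Variables (R : realType) (m k : nat) (lambda : R) (L : probability R R).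
Variable Q : probability ((m + m).-tuple R) R.
Hypothesis lambda_gt0 : 0 < lambda.
Hypothesis LE : laplace_law lambda L.
Hypothesis QE : iid_law L Q.
Hypothesis hk : (0 < k <= m)%N.
Variable S0 : set ({set 'I_m} * m.-tuple R).
Hypothesis mS0 : measurable S0.
Variables (x x' : 'I_m -> R) (s eta eps : R).
Hypothesis s2 : 2 <= s.
Hypothesis eta0 : 0 <= eta.
Hypothesis eta1 : eta <= 1 / 100.
Hypothesis seta : s * eta <= 1 / 8.
Hypothesis xe : forall i, `|x i - x' i| / lambda <= eta.

Let s0 : 0 <= s. Proof. exact: le_trans (ler0n _ _) s2. Qed.

Let xe' i : `|x' i - x i| / lambda <= eta. Proof. by rewrite distrC. Qed.

Let v := s ^+ 2 * eta ^+ 2.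

Let v0 : 0 <= v. Proof. by rewrite mulr_ge0// sqr_ge0. Qed.

Lemma tilt_weight0 (z : R) : tilt s 1 (laplace_weight lambda 0 z) = 1.
Proof. by rewrite laplace_weight0 /tilt subrr mulr0 expR0 mulr1. Qed.

Lemma tilt_prod_weight (F : 'I_m -> R) : (forall i, 0 < F i) ->
  tilt s 1 (\prod_i F i) = \prod_i tilt s 1 (F i).
Proof.
by move=> F0; rewrite -(tilt_prod _ _ _ (fun=> ler01))// big1_eq.
Qed.

(** The fresh noises are independent of everything [Phi] reads, so each is integrated alone: a
    selected item contributes at most [1 + 3 * v], an unshifted one exactly 1. *)
Lemma mean_tilt_values (sigma : {set 'I_m}) (j : 'I_m)
    (Phi : (m + m).-tuple R -> R) :
  #|sigma| = k -> nonneg_measurable Phi ->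
  (forall i z y, Phi (upd (rshift m i) z y) = Phi y) ->
  (mean Q (fun y => ((\prod_i tilt s 1 (laplace_weight lambda
      (if i \in sigma then x' i - x i else 0) (val_noise y i))) * Phi y)%R) <=
   ((1 + 3 * v) ^+ k)%:E * mean Q Phi)%E.
Proof.
move=> cs nPhi Phiu.
pose b i := if i \in sigma then x' i - x i else 0.
pose w i z : R := tilt s 1 (laplace_weight lambda (b i) z).
have nw i : nonneg_measurable (w i) by exact: nonneg_tilt_weight.
have mw i : (mean L (w i) <= (if i \in sigma then 1 + 3 * v else 1)%:E)%E.
  rewrite /w /b; case: ifP => _; first exact: laplace_weight_moment.
  rewrite -[leRHS](mean_cst L) (@eq_mean _ _ _ _ _ (fun=> 1))// => z.
  exact: tilt_weight0.
have fw i : (fine (mean L (w i)))%:E = mean L (w i).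
  rewrite fineK// ge0_fin_numE ?(mean_ge0 _ (nw i))//.
  by apply: le_lt_trans (mw i) _; rewrite ltry.
have := @resample_prod _ _ L Q QE 'I_m (@rshift m m) (lshift m j)
  (fun i z _ => w i z) (fun i _ => fine (mean L (w i))) Phi (index_enum 'I_m).
rewrite /mean => ->; last 9 first.
- exact: rshift_inj.
- exact: index_enum_uniq.
- by move=> i _; rewrite eq_rlshift.
- by move=> i z _; exact: (nw i).2.
- move=> i; exact: measurableT_comp (nw i).1 measurable_fst.
- by move=> i _; rewrite fw.
- exact: nPhi.1.
- exact: nPhi.2.
- by move=> i z y _; exact: Phiu.
have W0 i : 0 <= fine (mean L (w i)) by rewrite fine_ge0// mean_ge0.
rewrite -/(mean Q (fun y => (\prod_i fine (mean L (w i))) * Phi y)).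
rewrite (meanZ Q _ nPhi) ?prodr_ge0// lee_wpmul2r ?mean_ge0//.
rewrite lee_fin; apply: (prod_if_const cs) => // i.
by rewrite -lee_fin fw.
Qed.

(** Translating the noise makes the pivot level and the releases identical under both databases. The
    two likelihoods are then compared pointwise by [le_tilt], whose tilt factors into the parts of
    the other items, of the pivot and of the releases. *)
Lemma pivot_bound (sigma : {set 'I_m}) j : #|sigma| = k -> j \in sigma ->
  (mean Q (fun y => (pivot_prob L sigma j x (x j + sel_noise y j) *
      hit S0 sigma x y)%R) <=
   (expR eps)%:E * mean Q (fun y =>
      (pivot_prob L sigma j x' (x' j + sel_noise y j) * hit S0 sigma x' y)%R) +
   (expR (- (s * eps)) * expR (s * eta) * (1 + 3 * v) ^+ k)%:E *
   mean Q (fun y => pivot_tilt L s sigma j x x' (x j + sel_noise y j)%R))%E.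
Proof.
move=> cs js.
pose a i := if i == j then x' i - x i else 0.
pose b i := if i \in sigma then x' i - x i else 0.
pose W := shift_weight lambda a b.
pose psi y := pivot_prob L sigma j x' (x j + sel_noise y j) * hit S0 sigma x y.
pose V y := \prod_i tilt s 1 (laplace_weight lambda (b i) (val_noise y i)).
pose Phi y := pivot_tilt L s sigma j x x' (x j + sel_noise y j).
have nW : nonneg_measurable W by exact: nonneg_shift_weight.
have npsi : nonneg_measurable psi.
  apply: nonneg_measurableM; last exact: nonneg_hit.
  exact: (nonneg_pivot_level x j (nonneg_pivot_prob L sigma j x')).
have nPhi : nonneg_measurable Phi.
  exact: (nonneg_pivot_level x j (nonneg_pivot_tilt L s sigma j x x')).
have nV : nonneg_measurable V.
  apply: nonneg_measurable_prod => i.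
  exact: (nonneg_measurable_comp (nonneg_tilt_weight lambda s (b i))
    (measurable_val_noise i)).
have -> : mean Q (fun y => pivot_prob L sigma j x' (x' j + sel_noise y j) *
    hit S0 sigma x' y) = mean Q (fun y => psi y * W y).
  rewrite -(mean_shifted lambda_gt0 LE QE a b npsi).
  apply: eq_mean => y; rewrite /psi sel_noise_shifted /a eqxx.
  congr (pivot_prob _ _ _ _ _ * _); first by ring.
  rewrite /hit; congr (\1_ _ _); apply: eq_from_tnth => i.
  rewrite !tnth_mktuple val_noise_shifted /b.
  by case: (i \in sigma) => //; ring.
set C1 := expR (- (s * eps)) * expR (s * eta).
have C10 : 0 <= C1 by rewrite mulr_ge0// expR_ge0.
have nR := nonneg_measurableM nV nPhi.
have npsiW := nonneg_measurableM npsi nW.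
apply: (@le_trans _ _ ((expR eps)%:E * mean Q (fun y => (psi y * W y)%R) +
    C1%:E * mean Q (fun y => (V y * Phi y)%R))%E); last first.
  rewrite leeD2l// (EFinM C1) -muleA lee_wpmul2l ?lee_fin//.
  have Phiu i z y : Phi (upd (rshift m i) z y) = Phi y.
    by rewrite /Phi /sel_noise tnth_upd eq_lrshift.
  exact: (mean_tilt_values j cs nPhi Phiu).
rewrite -(meanZ Q (expR_ge0 _) npsiW) -(meanZ Q C10 nR).
have n1 := nonneg_measurableM (nonneg_measurable_cst _ (expR_ge0 eps)) npsiW.
have n2 := nonneg_measurableM (nonneg_measurable_cst _ C10) nR.
rewrite -(meanD Q n1 n2).
have n0 : nonneg_measurable (fun y =>
    pivot_prob L sigma j x (x j + sel_noise y j) * hit S0 sigma x y).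
  apply: nonneg_measurableM; last exact: nonneg_hit.
  exact: (nonneg_pivot_level x j (nonneg_pivot_prob L sigma j x)).
apply: (le_mean Q n0 (nonneg_measurableD n1 n2)) => y.
have [h0|h1] : hit S0 sigma x y = 0 \/ hit S0 sigma x y = 1.
  by rewrite /hit indicE; case: (_ \in _); [right|left].
  by rewrite h0 mulr0; exact: (nonneg_measurableD n1 n2).2.
rewrite /psi h1 !mulr1; set t := x j + sel_noise y j.
have sp z i c := side_prob_ge0 L z i j c t.
have pp i c : 0 < side_prob L x i j c t -> 0 < side_prob L x' i j c t.
  move=> p0; rewrite -(pmulr_rgt0 _ (expR_gt0 eta)); apply: lt_le_trans p0 _.
  by apply: (side_prob_ratio lambda_gt0 LE); exact: xe.
have w0 c z : 0 < laplace_weight lambda c z by exact: laplace_weight_gt0.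
have Wgt0 : 0 < W y.
  by rewrite /W /shift_weight mulr_gt0//; apply: prodr_gt0.
have ppi : 0 < pivot_prob L sigma j x t -> 0 < pivot_prob L sigma j x' t.
  rewrite !lt0r => /andP[/prodf_neq0 h _]; rewrite prodr_ge0// andbT.
  apply/prodf_neq0 => i ij; rewrite gt_eqF// pp//.
  by rewrite lt0r h ?sp.
have pi0 z : 0 <= pivot_prob L sigma j z t by exact: prodr_ge0.
apply: le_trans
  (le_tilt eps s0 (pi0 x) (_ : 0 <= pivot_prob L sigma j x' t * W y) _) _.
- by rewrite mulr_ge0// ltW.
- by move=> /ppi p0; rewrite mulr_gt0.
have E1 : tilt s (pivot_prob L sigma j x t) (pivot_prob L sigma j x' t) = Phi y.
  by rewrite /pivot_prob tilt_prod// => i; exact: pp.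
(* The noise of the pivot also determines [t], on which [Phi] depends, so its weight is bounded
   pointwise; the releases keep their exact tilt, which is averaged by [mean_tilt_values]. *)
have E2 : tilt s 1 (W y) <= expR (s * eta) * V y.
  rewrite -[X in tilt s X _](mulr1 1) /W /shift_weight tiltM//; last 2 first.
  - by move=> _; apply: prodr_gt0 => i _.
  - by move=> _; apply: prodr_gt0 => i _.
  rewrite !tilt_prod_weight// ler_wpM2r//; first exact: nV.2.
  rewrite (bigD1 j)//= big1 ?mulr1; last first.
    by move=> i /negbTE ij; rewrite /a ij tilt_weight0.
  by rewrite /a eqxx; exact: tilt_weight_le.
rewrite lerD2l /C1 -!mulrA ler_pM2l ?expR_gt0//.
rewrite -{1}(mulr1 (pivot_prob L sigma j x t)) tiltM// E1 mulrC mulrA.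
by rewrite ler_wpM2r// nPhi.2.
Qed.

(** Summing [pivot_bound] over selections and pivots rebuilds the probability under [x']. In the
    error term the sums are exchanged: each of the [m] pivots costs at most [expR (6 * v * k%:R)],
    and the releases cost a factor of at most [expR (3 * v * k%:R)]. *)
Lemma approximate_bound :
  (Q (output_event k S0 x) <= (expR eps)%:E * Q (output_event k S0 x') +
   (m%:R * expR (- (s * eps) + s * eta + 9 * v * k%:R))%:E)%E.
Proof.
rewrite !(output_mean _ hk mS0).
set C1 := expR (- (s * eps)) * expR (s * eta) * (1 + 3 * v) ^+ k.
have C10 : 0 <= C1.
  by rewrite !mulr_ge0 ?expR_ge0// exprn_ge0// addr_ge0// mulr_ge0.
pose M z (sigma : {set 'I_m}) j := mean Q (fun y =>
  (pivot_prob L sigma j z (z j + sel_noise y j) * hit S0 sigma z y)%R).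
pose H (sigma : {set 'I_m}) j :=
  mean Q (fun y => pivot_tilt L s sigma j x x' (x j + sel_noise y j)%R).
have nH (sigma : {set 'I_m}) j : nonneg_measurable (fun y : (m + m).-tuple R =>
    pivot_tilt L s sigma j x x' (x j + sel_noise y j)%R).
  exact: (nonneg_pivot_level x j (nonneg_pivot_tilt L s sigma j x x')).
have M0 z sigma j : (0 <= M z sigma j)%E.
  apply: mean_ge0; apply: nonneg_measurableM; last exact: nonneg_hit.
  exact: (nonneg_pivot_level z j (nonneg_pivot_prob L sigma j z)).
have H0 sigma j : (0 <= H sigma j)%E by exact: mean_ge0.
have ME z : (\sum_(sigma : {set 'I_m} | #|sigma| == k)
      mean Q (fun y => (selected k z y == sigma)%:R * hit S0 sigma z y)%R =
    \sum_(sigma : {set 'I_m} | #|sigma| == k) \sum_(j in sigma) M z sigma j)%E.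
  apply: eq_bigr => sigma /eqP cs; exact: mean_selected_pivot.
rewrite !ME.
apply: (@le_trans _ _ (\sum_(sigma : {set 'I_m} | #|sigma| == k)
   \sum_(j in sigma) ((expR eps)%:E * M x' sigma j + C1%:E * H sigma j))%E).
  apply: lee_sum => sigma /eqP cs; apply: lee_sum => j js; exact: pivot_bound.
have -> : (\sum_(sigma : {set 'I_m} | #|sigma| == k) \sum_(j in sigma)
   ((expR eps)%:E * M x' sigma j + C1%:E * H sigma j) =
   (expR eps)%:E * (\sum_(sigma : {set 'I_m} | #|sigma| == k)
     \sum_(j in sigma) M x' sigma j) +
   C1%:E * \sum_(sigma : {set 'I_m} | #|sigma| == k)
     \sum_(j in sigma) H sigma j)%E.
  rewrite !ge0_sume_distrr; try by move=> *; apply: sume_ge0.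
  rewrite -big_split/=; apply: eq_bigr => sigma _.
  by rewrite !ge0_sume_distrr// -big_split.
rewrite leeD2l//.
have Hsum : (\sum_(sigma : {set 'I_m} | #|sigma| == k)
    \sum_(j in sigma) H sigma j <= (m%:R * expR (6 * v * k%:R))%:E)%E.
  rewrite (exchange_big_dep predT)//=.
  have -> : m%:R * expR (6 * v * k%:R) = \sum_(j < m) expR (6 * v * k%:R).
    by rewrite sumr_const card_ord mulr_natl.
  rewrite -sumEFin; apply: lee_sum => j _; rewrite -mean_sum// -(mean_cst Q).
  apply: le_mean.
  - exact: nonneg_measurable_sum.
  - by apply: nonneg_measurable_cst; exact: expR_ge0.
  - by move=> y; apply: (pivot_tilt_sum k lambda_gt0 LE).
apply: (@le_trans _ _ (C1%:E * (m%:R * expR (6 * v * k%:R))%:E)%E).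
  by rewrite lee_wpmul2l.
rewrite -EFinM lee_fin mulrCA ler_wpM2l// /C1 !expRD.
have -> : expR (9 * v * k%:R) = expR (3 * v) ^+ k * expR (6 * v * k%:R).
  by rewrite -expRM_natr -expRD; congr expR; ring.
rewrite mulrA ler_pM2r ?expR_gt0// ler_pM2l ?mulr_gt0 ?expR_gt0//.
by rewrite lerXn2r ?nnegrE ?expR_ge0 ?expR_ge1Dx// addr_ge0// mulr_ge0.
Qed.

End approximate.

(** * Calibration *)

Section scale.
Variables (R : realType) (m k : nat) (eps delta : R).
Hypothesis hm : (2 <= m)%N.
Hypothesis k0 : (0 < k)%N.
Hypothesis heps : 0 < eps <= 1 / 5.
Hypothesis hdelta : 0 < delta <= 1 / 20.

Let Lg := ln (m%:R / delta).
Let q := Num.sqrt (k%:R * Lg).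
Let eta := eps / (8 * q).
Let s := 2 * Lg / eps.

Lemma log_ratio_ge2 : 2 <= Lg.
Proof.
have /andP[d0 d1] := hdelta.
have m2 : 2 <= m%:R :> R by rewrite (ler_nat _ 2).
have : 16 <= m%:R / delta by rewrite ler_pdivlMr//; lra.
have e16 : expR 2 <= 16 :> R.
  (* [expR (- (1 / 2)) >= 1 / 2] gives [expR (1 / 2) <= 2], whose fourth power is the claim. *)
  have := expR_ge1Dx (- (1 / 2) : R); rewrite expRN => h.
  have e0 := expR_gt0 (1 / 2 : R).
  have e2 : expR (1 / 2) <= 2 :> R.
    rewrite -[leRHS]invrK -[leLHS]invrK lef_pV2 ?posrE ?invr_gt0//.
    by apply: le_trans h; lra.
  have -> : expR 2 = expR (1 / 2) ^+ 4 :> R.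
    by rewrite -expRM_natl; congr expR; field.
  rewrite (_ : 16 = 2 ^+ 4); last by ring.
  by rewrite lerXn2r ?nnegrE// ltW.
move=> /(le_trans e16) h.
by rewrite -[leLHS]expRK ler_ln ?posrE ?expR_gt0// (lt_le_trans _ h)// expR_gt0.
Qed.

Let q2 : q ^+ 2 = k%:R * Lg.
Proof. by rewrite sqr_sqrtr// mulr_ge0// (le_trans _ log_ratio_ge2). Qed.

Let k1 : 1 <= k%:R :> R. Proof. by rewrite (ler_nat _ 1). Qed.

Lemma sqrt_scale_ge1 : 1 <= q.
Proof.
rewrite -[leLHS]sqrtr1 ler_wsqrtr//.
by have := log_ratio_ge2; have := k1; nra.
Qed.

Lemma shift_bound_ge0 : 0 <= eta.
Proof.
have /andP[e0 e1] := heps.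
by rewrite divr_ge0 ?(ltW e0)// mulr_ge0// (le_trans _ sqrt_scale_ge1).
Qed.

(** From [k < 4 * Lg] follows [k / 2 <= q], so the cost is at most [3 / 4 * eps]. *)
Lemma pure_budget : k%:R < 4 * Lg -> 3 * k%:R * eta <= eps.
Proof.
move=> kL; have /andP[e0 e1] := heps.
have qk : k%:R / 2 <= q.
  rewrite -(@ler_pXn2r _ 2)// ?nnegrE ?q2 ?divr_ge0//; last first.
    by rewrite (le_trans _ sqrt_scale_ge1).
  by have := k1; rewrite expr_div_n; nra.
rewrite /eta mulrCA -[leRHS]mulr1 ler_pM2l// ler_pdivrMr; last first.
  by have := sqrt_scale_ge1; lra.
have := k1; lra.
Qed.

Section large_k.
Hypothesis kL : 4 * Lg <= k%:R.

(** Here [q ^+ 2 = k * Lg >= (2 * Lg) ^+ 2]; this lower bound on [q] keeps both [eta] and [s * eta]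
    small. *)
Let qL : 2 * Lg <= q.
Proof.
have := log_ratio_ge2 => L1.
have L0 : 0 <= Lg by apply: le_trans L1.
have h : (2 * Lg) ^+ 2 <= q ^+ 2.
  rewrite q2; apply: le_trans (ler_wpM2r L0 kL).
  by rewrite (_ : _ ^+ 2 = 4 * Lg * Lg)//; ring.
rewrite -(@ler_pXn2r _ 2)// nnegrE; first by lra.
by rewrite (le_trans _ sqrt_scale_ge1).
Qed.

Let sE : s * eta = Lg / (4 * q).
Proof.
have /andP[e0 e1] := heps.
by rewrite /s /eta; field; rewrite !gt_eqF// (lt_le_trans _ sqrt_scale_ge1).
Qed.

Lemma moment_order_ge2 : 2 <= s.
Proof.
have /andP[e0 e1] := heps; have := log_ratio_ge2 => L1.
by rewrite /s ler_pdivlMr//; nra.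
Qed.

Lemma shift_bound_small : eta <= 1 / 100.
Proof.
have /andP[e0 e1] := heps; have := log_ratio_ge2 => L1; have := qL => ?.
have q0 : 0 < 8 * q by rewrite mulr_gt0// (lt_le_trans _ sqrt_scale_ge1).
by rewrite /eta ler_pdivrMr//; lra.
Qed.

Lemma moment_shift_small : s * eta <= 1 / 8.
Proof.
have := log_ratio_ge2 => L1; have := qL => h.
have q0 : 0 < 4 * q by rewrite mulr_gt0// (lt_le_trans _ sqrt_scale_ge1).
by rewrite sE ler_pdivrMr//; lra.
Qed.

(** The exponent is [- 2 * Lg + s * eta + 9 / 16 * Lg] with [s * eta <= 1 / 8], hence at most [- Lg]
    because [Lg >= 2]; and [m * expR (- Lg)] is [delta]. *)
Lemma approximate_budget : m%:R *
  expR (- (s * eps) + s * eta + 9 * (s ^+ 2 * eta ^+ 2) * k%:R) <= delta.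
Proof.
have /andP[e0 e1] := heps; have /andP[d0 d1] := hdelta.
have := log_ratio_ge2 => L1; have := k1 => k1'.
have m0 : 0 < m%:R :> R by rewrite ltr0n (leq_trans _ hm).
have -> : s * eps = 2 * Lg by rewrite /s mulfVK// gt_eqF.
have -> : s ^+ 2 * eta ^+ 2 = Lg / (16 * k%:R).
  rewrite -exprMn sE expr_div_n exprMn q2; field.
  by rewrite !gt_eqF//; lra.
have -> : 9 * (Lg / (16 * k%:R)) * k%:R = 9 / 16 * Lg.
  by field; rewrite gt_eqF//; lra.
have := moment_shift_small => h.
apply: (@le_trans _ _ (m%:R * expR (- Lg))).
  by rewrite ler_pM2l// ler_expR; lra.
rewrite expRN /Lg lnK ?posrE ?divr_gt0// invf_div mulrCA divff ?mulr1//.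
by rewrite gt_eqF.
Qed.

End large_k.
End scale.

(** * Sensitivity and the privacy theorem *)

Lemma le_sensitivity (R : realType) (X : choiceType) (m : nat)
    (f : 'I_m -> database X -> R) D D' i :
  has_ubound (adjacent_changes f) -> adjacent_db D D' ->
  `|f i D - f i D'| <= sensitivity f.
Proof.
move=> hf DD'.
apply: (@le_trans _ _ (\big[Num.max/0]_(i < m) `|f i D - f i D'|)).
  exact: (le_bigmax _ (fun i => `|f i D - f i D'|)).
by apply: ub_le_sup => //; exists (D, D').
Qed.

Theorem theorem2p2 (R : realType) (X : choiceType) (m k : nat)
    (f : 'I_m -> database X -> R) (eps delta lambda : R)
    (d : measure_display) (T : measurableType d) (P : probability T R)
    (g g' : 'I_m -> {RV P >-> R})
    (hm : (2 <= m)%N) (hk : (1 <= k <= m)%N)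
    (hf : has_ubound (adjacent_changes f))
    (heps : 0 < eps <= 1 / 5) (hdelta : 0 < delta <= 1 / 20)
    (hlambda : 0 < lambda)
    (hscale :
      8 * sensitivity f * Num.sqrt (k%:R * ln (m%:R / delta)) / eps <= lambda)
    (hg : forall i, laplace_distributed (g i) lambda)
    (hg' : forall i, laplace_distributed (g' i) lambda)
    (hind : mutually_independent
      (fun x : 'I_m + 'I_m => match x with inl i => g i | inr i => g' i end)) :
  differentially_private (oneshot_laplace k f g g') eps delta.
Proof.
have /andP[k0 km] := hk.
have i0 : 'I_m := Ordinal (leq_trans k0 km).
pose L := distribution P (g i0).
(* All [2 m] noises form one vector with i.i.d. coordinates of law [L], of which the mechanism is a
   function. *)
pose Z t := [tuple pair_vector (g ^~ t) (g' ^~ t) i | i < m + m].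
have mZ : measurable_fun setT Z.
  apply/measurable_fun_tnthP => i.
  rewrite (_ : _ \o _ = pair_vector g g' i :> (T -> R)) //.
  apply/funext => t; rewrite /= tnth_mktuple /pair_vector.
  by case: fintype.split.
pose ZZ : {mfun T >-> (m + m).-tuple R} :=
  HB.pack Z (isMeasurableFun.Build _ _ _ _ _ mZ).
pose Q : probability ((m + m).-tuple R) R := distribution P ZZ.
have LE A : measurable A ->
    L A = (\int[lebesgue_measure]_(z in A) (laplace_pdf lambda z)%:E)%E.
  exact: hg.
have selZ t i : sel_noise (Z t) i = g i t.
  by rewrite /sel_noise tnth_mktuple pair_vector_lshift.
have valZ t i : val_noise (Z t) i = g' i t.
  by rewrite /val_noise tnth_mktuple pair_vector_rshift.
have QE A : (forall i, measurable (A i)) ->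
    Q [set y | forall i, A i (tnth y i)] = (\prod_i L (A i))%E.
  move=> mA.
  pose A' (x : 'I_m + 'I_m) :=
    match x with inl i => A (lshift m i) | inr i => A (rshift m i) end.
  have mA' x : measurable (A' x) by case: x => i; exact: mA.
  have := hind finset.setT A' mA'.
  rewrite (eq_bigl predT) => [|z]; last by rewrite finset.in_setT.
  rewrite big_sumType/= big_split_ord => E.
  apply: (etrans _ (etrans E _)).
    congr (P _); apply/seteqP; split => t /=.
      move=> h [] i _ /=.
        by have := h (lshift m i); rewrite tnth_mktuple pair_vector_lshift.
      by have := h (rshift m i); rewrite tnth_mktuple pair_vector_rshift.
    move=> h i; rewrite -(splitK i); case: (fintype.split i) => j /=.
      rewrite tnth_mktuple pair_vector_lshift; apply: (h (inl j)).
      exact: finset.in_setT.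
    rewrite tnth_mktuple pair_vector_rshift; apply: (h (inr j)).
    exact: finset.in_setT.
  congr (_ * _)%E; apply: eq_bigr => i _.
    by rewrite LE//; exact: hg.
  by rewrite LE//; exact: hg'.
move=> D D' DD' S mS.
have PQ D1 : P (oneshot_laplace k f g g' D1 @^-1` S) =
    Q (output_event k S (f ^~ D1)).
  rewrite /Q /distribution /pushforward; congr (P _); apply/seteqP.
  have oE t : oneshot_output k f D1 (fun i => g i t) (fun i => g' i t) =
      (selected k (f ^~ D1) (Z t),
       released (selected k (f ^~ D1) (Z t)) (f ^~ D1) (Z t)).
    have sE : selected k (f ^~ D1) (Z t) =
        smallest_indices k (fun i => f i D1 + g i t).
      rewrite /selected; congr smallest_indices.
      by apply/funext => i; rewrite selZ.
    rewrite /oneshot_output sE; congr pair; apply: eq_from_tnth => i.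
    by rewrite !tnth_mktuple valZ.
  by split => t /=; rewrite /oneshot_laplace_fun oE.
rewrite !PQ.
set Lg := ln (m%:R / delta) in hscale *; set q := Num.sqrt _ in hscale.
pose eta := eps / (8 * q).
have /andP[e0 e1] := heps; have /andP[d0 d1] := hdelta.
have q0 : 0 < q by apply: lt_le_trans (sqrt_scale_ge1 hm k0 hdelta).
have eta0 : 0 <= eta := shift_bound_ge0 hm k0 heps hdelta.
have sens i : `|f i D - f i D'| / lambda <= eta.
  rewrite ler_pdivrMr//; apply: le_trans (le_sensitivity i hf DD') _.
  (* The sensitivity is the fraction [eta] of the prescribed scale, which [lambda] dominates. *)
  have -> : sensitivity f = eta * (8 * sensitivity f * q / eps).
    by rewrite /eta; field; rewrite !gt_eqF.
  by rewrite ler_wpM2l.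
(* Large [k] uses the moment bound over the pivots; for small [k] the noise shift gives pure
   privacy, and adding [delta] only weakens the bound. *)
have [kL|kL] := leP (4 * Lg) k%:R.
- have s2 := moment_order_ge2 hm heps hdelta.
  have eta1 := shift_bound_small hm k0 heps hdelta kL.
  have seta := moment_shift_small hm k0 heps hdelta kL.
  apply: le_trans
    (approximate_bound hlambda LE QE hk mS eps s2 eta0 eta1 seta sens) _.
  by rewrite leeD2l// lee_fin; exact: approximate_budget.
- rewrite !(output_mean Q hk mS).
  apply: (@le_trans _ _ ((expR eps)%:E *
    \sum_(sigma : {set 'I_m} | #|sigma| == k) mean Q (fun y =>
      (selected k (f ^~ D') y == sigma)%:R *
      hit S sigma (f ^~ D') y)%R)%E); last first.
    by rewrite leeDl// lee_fin ltW.
  have n1 sigma : nonneg_measurable (fun y =>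
      (selected k (f ^~ D') y == sigma)%:R * hit S sigma (f ^~ D') y).
    by apply: nonneg_measurableM; [exact: nonneg_selected|exact: nonneg_hit].
  rewrite ge0_sume_distrr => [|sigma _]; last exact: mean_ge0.
  apply: lee_sum => sigma /eqP cs.
  have sens' i : `|f i D - f i D'| <= eta * lambda by rewrite -ler_pdivrMr.
  apply: le_trans (pure_selection_bound hlambda LE QE hk mS sens' cs) _.
  rewrite lee_wpmul2r ?mean_ge0// lee_fin ler_expR mulfK ?gt_eqF//.
  exact: (pure_budget hm k0 heps hdelta).
Qed.
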